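(* Let $\mathcal{C}$ be a Heyting pretopos with an (indexed) natural number object and a class $\mathcal{S}$ of small maps. Assume that $\mathcal{S}$ also satisfies: (P2) if $X\to B$ belongs to $\mathcal{S}$, then so does $\mathcal{P}_s(X\to B)$; (M) every monomorphism is small; (C) for any two arrows $p:Y\to X$ and $f:X\to A$ where $p$ is epi and $f$ belongs to $\mathcal{S}$, there exist maps $Z\to Y$, $g:Z\to B$ and $h:B\to A$, with $h$ epi and $g$ in $\mathcal{S}$, such that the square with sides $Z\to Y\xrightarrow{p}X$, $g:Z\to B$, $f:X\to A$, $h:B\to A$ is a quasi-pullback. Let $E:V\to\mathcal{P}_sV$ be the (indexed) final $\mathcal{P}_s$-coalgebra, regarded as a model of set theory by letting quantifiers range over $V$, interpreting $x\,\epsilon\,y$ as $x\in E(y)$ in the internal logic of $\mathcal{C}$, and interpreting $\omega$ as a suitable global element $1\to V$. If the pretopos $\mathcal{C}$ is Boolean, then classical logic is also true in this model, which therefore validates $\mathbf{ZF}^-+\mathbf{AFA}$, Zermelo-Fraenkel set theory with Anti-Foundation instead of Foundation.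
   Context: An (indexed) natural number object in $\mathcal{C}$ is an object $\mathbb{N}$ with maps $0:1\to\mathbb{N}$, $s:\mathbb{N}\to\mathbb{N}$ such that for any $f:P\to Y$ and $t:P\times Y\to Y$ there is a unique $\bar f:P\times\mathbb{N}\to Y$ with $\bar f\circ\langle \mathrm{id},0\rangle=f$ and $\bar f\circ(\mathrm{id}\times s)=t\circ\langle p_1,\bar f\rangle$. A class $\mathcal{S}$ of arrows of $\mathcal{C}$ is a class of small maps if it satisfies: (S1) $\mathcal{S}$ contains identities and is closed under composition; (S2) $\mathcal{S}$ is stable under pullback along arbitrary maps; (S3) every diagonal $\Delta_C:C\to C\times C$ is in $\mathcal{S}$; (S4) if $e:C\to D$ is epi, $g:D\to A$, and $ge\in\mathcal{S}$, then $g\in\mathcal{S}$; (S5) if $f:C\to A$ and $g:D\to A$ are in $\mathcal{S}$, so is $[f,g]:C+D\to A$; (P1) for every object $C$ there is an object $\mathcal{P}_s(C)$ and a natural (in $I$) bijection between maps $I\to\mathcal{P}_s(C)$ and small relations between $I$ and $C$, i.e. subobjects $R\rightarrowtail I\times C$ whose composite with the projection to $I$ is in $\mathcal{S}$; (I) $\mathbb{N}\to 1$ is in $\mathcal{S}$; (R) there is a universal small map $\pi:E\to U$ in $\mathcal{S}$: for every $f:A\to B$ in $\mathcal{S}$ there are an epi $q:B'\to B$ and a map $B'\to U$ such that the pullback of $f$ along $q$ is isomorphic over $B'$ to the pullback of $\pi$ along $B'\to U$. Arrows in $\mathcal{S}$ are called small. $\mathcal{P}_s$ is a covariant functor via direct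 images, and $\in_C\subseteq\mathcal{P}_s(C)\times C$ is the small relation corresponding to $\mathrm{id}_{\mathcal{P}_s(C)}$. $\mathcal{S}$ induces a class of small maps on each slice $\mathcal{C}/B$ (morphisms whose underlying map is in $\mathcal{S}$), hence powerclass functors $\mathcal{P}_s^B$ on $\mathcal{C}/B$; $\mathcal{P}_s(X\to B)$ denotes the powerclass object, in $\mathcal{C}/B$, of the object $X\to B$, regarded as a map with codomain $B$. The indexed final $\mathcal{P}_s$-coalgebra (which exists under the stated assumptions on $\mathcal{C}$) is a coalgebra $(V,E)$ such that $I^*(V,E)$ is a terminal $\mathcal{P}_s^I$-coalgebra for all $I$. A commutative square is a quasi-pullback if the mediating arrow from its initial corner to the pullback is epic. $\mathbf{CZF}_0$ is the first-order theory with intuitionistic logic, a binary relation symbol $\epsilon$ and a constant $\omega$, with axioms the universal closures of: (Extensionality) $\forall x(x\,\epsilon\,a\leftrightarrow x\,\epsilon\,b)\to a=b$; (Pairing) $\exists t\forall z(z\,\epsilon\,t\leftrightarrow(z=x\lor z=y))$; (Union) $\exists t\forall z(z\,\epsilon\,t\leftrightarrow\exists y(z\,\epsilon\,y\land y\,\epsilon\,x))$; (Emptyset) $\exists x\forall z(z\,\epsilon\,x\leftrightarrow\bot)$; (Intersection) $\exists t\forall z(z\,\epsilon\,t\leftrightarrow(z\,\epsilon\,a\land z\,\epsilon\,b))$; (Replacement) $\forall x\,\epsilon\,a\,\exists!y\,\phi\to\exists z\forall y(y\,\epsilon\,z\leftrightarrow\exists x\,\epsilon\,a\,\phi)$, for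 all formulas $\phi$; (Infinity-1) $\emptyset\,\epsilon\,\omega\land\forall x\,\epsilon\,\omega\,(sx\,\epsilon\,\omega)$; (Infinity-2) $\psi(\emptyset)\land\forall x\,\epsilon\,\omega\,(\psi(x)\to\psi(sx))\to\forall x\,\epsilon\,\omega\,\psi(x)$, for all formulas $\psi$; where $\emptyset$ is the empty set and $sx=x\cup\{x\}$. $\mathbf{IZF}^-$ is $\mathbf{CZF}_0$ plus the universal closures of: (Powerset) $\exists y\forall z(z\,\epsilon\,y\leftrightarrow\forall w\,\epsilon\,z\,(w\,\epsilon\,x))$; (Full Separation) $\exists y\forall z(z\,\epsilon\,y\leftrightarrow z\,\epsilon\,x\land\phi)$, for all formulas $\phi$ in which $y$ does not occur; (Collection) $\forall y\,\epsilon\,x\,\exists w\,\phi\to\exists z\,\forall y\,\epsilon\,x\,\exists w\,\epsilon\,z\,\phi$, for all formulas $\phi$. $\mathbf{ZF}^-$ is $\mathbf{IZF}^-$ with classical logic (i.e. Zermelo-Fraenkel set theory without Foundation). (AFA) Every graph has a unique colouring. Here a graph is a pair of sets $(n,e)$ with $e\subseteq n\times n$, and a colouring of it is a function $c$ assigning to every $x\,\epsilon\,n$ a set $c(x)$ such that $c(x)=\{c(y)\mid(x,y)\,\epsilon\,e\}$; pairs and functions are encoded in the standard way in terms of $\epsilon$. *)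

(* Defs.v *)
From Stdlib Require Import Fin ProofIrrelevance.

Set Implicit Arguments.
Unset Strict Implicit.
Unset Printing Implicit Defensive.

(** * Categories with finite limits *)

Record category := Category {
  ob :> Type;
  hom : ob -> ob -> Type;
  idm : forall X, hom X X;
  comp : forall X Y Z, hom Y Z -> hom X Y -> hom X Z;
  comp_idl : forall X Y (f : hom X Y), comp (idm Y) f = f;
  comp_idr : forall X Y (f : hom X Y), comp f (idm X) = f;
  comp_assoc : forall X Y Z W (h : hom Z W) (g : hom Y Z) (f : hom X Y),
    comp h (comp g f) = comp (comp h g) f
}.
Arguments hom {_} _ _.
Arguments idm {_} _.
Arguments comp {_ _ _ _} _ _.

Declare Scope cat_scope.
Delimit Scope cat_scope with cat.
Open Scope cat_scope.
Notation "g ∘ f" := (comp g f) (at level 40, left associativity) : cat_scope.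

Definition mono (C : category) (X Y : C) (m : hom X Y) : Prop :=
  forall T (u v : hom T X), m ∘ u = m ∘ v -> u = v.

Definition epi (C : category) (X Y : C) (e : hom X Y) : Prop :=
  forall T (u v : hom Y T), u ∘ e = v ∘ e -> u = v.

Definition iso (C : category) (X Y : C) (f : hom X Y) : Prop :=
  exists g : hom Y X, g ∘ f = idm X /\ f ∘ g = idm Y.

Definition regular_epi (C : category) (X Y : C) (e : hom X Y) : Prop :=
  exists (K : C) (a b : hom K X),
    e ∘ a = e ∘ b /\
    forall Z (h : hom X Z), h ∘ a = h ∘ b -> exists! k : hom Y Z, k ∘ e = h.

Definition is_pullback (C : category) (P A B D : C)
    (p : hom P A) (q : hom P B) (f : hom A D) (g : hom B D) : Prop :=
  f ∘ p = g ∘ q /\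
  forall T (u : hom T A) (v : hom T B), f ∘ u = g ∘ v ->
    exists! h : hom T P, p ∘ h = u /\ q ∘ h = v.

Definition is_coproduct (C : category) (A B S : C)
    (i : hom A S) (j : hom B S) : Prop :=
  forall T (u : hom A T) (v : hom B T),
    exists! h : hom S T, h ∘ i = u /\ h ∘ j = v.

(* Finite limits, given by a chosen terminal object and chosen pullbacks. *)
Record lexcat := Lexcat {
  lex_cat :> category;
  one : lex_cat;
  bang : forall X : lex_cat, hom X one;
  bang_uniq : forall (X : lex_cat) (f g : hom X one), f = g;
  pb : forall A B D : lex_cat, hom A D -> hom B D -> lex_cat;
  pb1 : forall (A B D : lex_cat) (f : hom A D) (g : hom B D), hom (pb f g) A;
  pb2 : forall (A B D : lex_cat) (f : hom A D) (g : hom B D), hom (pb f g) B;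
  pb_comm : forall (A B D : lex_cat) (f : hom A D) (g : hom B D),
    f ∘ pb1 f g = g ∘ pb2 f g;
  pb_pair : forall (A B D : lex_cat) (f : hom A D) (g : hom B D)
    (T : lex_cat) (u : hom T A) (v : hom T B), f ∘ u = g ∘ v -> hom T (pb f g);
  pb_pair1 : forall (A B D : lex_cat) (f : hom A D) (g : hom B D)
    (T : lex_cat) (u : hom T A) (v : hom T B) (e : f ∘ u = g ∘ v),
    pb1 f g ∘ pb_pair e = u;
  pb_pair2 : forall (A B D : lex_cat) (f : hom A D) (g : hom B D)
    (T : lex_cat) (u : hom T A) (v : hom T B) (e : f ∘ u = g ∘ v),
    pb2 f g ∘ pb_pair e = v;
  pb_uniq : forall (A B D : lex_cat) (f : hom A D) (g : hom B D)
    (T : lex_cat) (h k : hom T (pb f g)),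
    pb1 f g ∘ h = pb1 f g ∘ k -> pb2 f g ∘ h = pb2 f g ∘ k -> h = k
}.
Arguments one {_}.
Arguments bang {_} _.
Arguments pb {_ _ _ _} _ _.
Arguments pb1 {_ _ _ _} _ _.
Arguments pb2 {_ _ _ _} _ _.
Arguments pb_pair {_ _ _ _ _ _ _ _ _} _.

Section Lex.
Variable C : lexcat.

Definition prod (A B : C) : C := pb (bang A) (bang B).
Definition pr1 (A B : C) : hom (prod A B) A := pb1 (bang A) (bang B).
Definition pr2 (A B : C) : hom (prod A B) B := pb2 (bang A) (bang B).
Definition pair (T A B : C) (u : hom T A) (v : hom T B) : hom T (prod A B) :=
  pb_pair (bang_uniq (bang A ∘ u) (bang B ∘ v)).
Definition prodmap (A B A' B' : C) (f : hom A A') (g : hom B B') :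
  hom (prod A B) (prod A' B') := pair (f ∘ pr1 A B) (g ∘ pr2 A B).
Definition diag (A : C) : hom A (prod A A) := pair (idm A) (idm A).

Lemma pr1_pair (T A B : C) (u : hom T A) (v : hom T B) : pr1 A B ∘ pair u v = u.
Proof. apply pb_pair1. Qed.
Lemma pr2_pair (T A B : C) (u : hom T A) (v : hom T B) : pr2 A B ∘ pair u v = v.
Proof. apply pb_pair2. Qed.
Lemma prod_uniq (T A B : C) (h k : hom T (prod A B)) :
  pr1 A B ∘ h = pr1 A B ∘ k -> pr2 A B ∘ h = pr2 A B ∘ k -> h = k.
Proof. apply pb_uniq. Qed.

Definition quasi_pullback (Z X B A : C)
    (a : hom Z X) (g : hom Z B) (f : hom X A) (h : hom B A) : Prop :=
  exists e : f ∘ a = h ∘ g, epi (pb_pair e).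

(** ** Subobjects, represented by monomorphisms *)

Record sub (X : C) := Sub {
  sub_ob :> C;
  sub_map : hom sub_ob X;
  sub_mono : mono sub_map
}.

Definition sub_le (X : C) (A B : sub X) : Prop :=
  exists h : hom A B, sub_map B ∘ h = sub_map A.
Definition sub_eq (X : C) (A B : sub X) : Prop := sub_le A B /\ sub_le B A.

(* [x] is a generalized element of [A] *)
Definition sub_in (X : C) (A : sub X) (T : C) (x : hom T X) : Prop :=
  exists h : hom T A, sub_map A ∘ h = x.

Lemma sub_pull_mono (X Y : C) (f : hom X Y) (B : sub Y) :
  mono (pb1 f (sub_map B)).
Proof.
intros T u v E; apply pb_uniq; [exact E|].
apply (@sub_mono _ B).
rewrite !comp_assoc, <- !pb_comm, <- !comp_assoc, E; reflexivity.
Qed.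
Definition sub_pull (X Y : C) (f : hom X Y) (B : sub Y) : sub X :=
  Sub (@sub_pull_mono X Y f B).

Lemma idm_mono (X : C) : mono (idm X).
Proof. intros T u v; rewrite !comp_idl; exact (fun e => e). Qed.
Definition sub_top (X : C) : sub X := Sub (@idm_mono X).

Lemma comp_mono (X Y Z : C) (m : hom Y Z) (k : hom X Y) :
  mono m -> mono k -> mono (m ∘ k).
Proof.
intros Hm Hk T u v E; apply Hk, Hm.
rewrite !comp_assoc; exact E.
Qed.
Definition sub_and (X : C) (A B : sub X) : sub X :=
  Sub (comp_mono (@sub_mono _ A) (@sub_mono _ (sub_pull (sub_map A) B))).

Lemma diag_mono (X : C) : mono (diag X).
Proof.
intros T u v E.
rewrite <- (comp_idl u), <- (comp_idl v).
rewrite <- (pr1_pair (idm X) (idm X)), <- !comp_assoc.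
exact (f_equal (fun x => pr1 X X ∘ x) E).
Qed.
Definition sub_diag (X : C) : sub (prod X X) := Sub (@diag_mono X).

Lemma sub_leP (X : C) (A B : sub X) :
  sub_le A B <-> forall T (x : hom T X), sub_in A x -> sub_in B x.
Proof.
split.
- intros [h Hh] T x [k Hk]; exists (h ∘ k).
  rewrite comp_assoc, Hh; exact Hk.
- intros H; apply (H _ (sub_map A)); exists (idm _); apply comp_idr.
Qed.

Lemma sub_in_pull (X Y : C) (f : hom X Y) (B : sub Y) T (x : hom T X) :
  sub_in (sub_pull f B) x <-> sub_in B (f ∘ x).
Proof.
split.
- intros [h Hh]; exists (pb2 f (sub_map B) ∘ h).
  rewrite comp_assoc, <- pb_comm, <- comp_assoc; simpl in Hh; rewrite Hh.
  reflexivity.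
- intros [h Hh]; exists (pb_pair (eq_sym Hh)); simpl; apply pb_pair1.
Qed.

(* An internal equivalence relation: [Hom(T, R)] is an equivalence relation on
   [Hom(T, X)] for every [T]. *)
Definition equivalence (X : C) (R : sub (prod X X)) : Prop :=
  (forall T (x : hom T X), sub_in R (pair x x)) /\
  (forall T (x y : hom T X), sub_in R (pair x y) -> sub_in R (pair y x)) /\
  (forall T (x y z : hom T X),
     sub_in R (pair x y) -> sub_in R (pair y z) -> sub_in R (pair x z)).

End Lex.
Arguments pr1 {_ _ _}.
Arguments pr2 {_ _ _}.
Arguments sub_top {_} _.
Arguments sub_map {_ _} _.

(** * Heyting pretoposes *)

(* A pretopos is an exact category with finite sums that are disjoint and
   stable under pullback; it is Heyting when pulling back subobjects along any
   map has a right adjoint.  The remaining operations on subobjects (joins and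
   Heyting implication) are derived from these below. *)
Record heyting_pretopos := HeytingPretopos {
  hp_lex :> lexcat;
  (* regularity *)
  image : forall (X Y : hp_lex) (f : hom X Y), sub Y;
  image_cover : forall (X Y : hp_lex) (f : hom X Y), hom X (image f);
  image_fact : forall (X Y : hp_lex) (f : hom X Y),
    sub_map (image f) ∘ image_cover f = f;
  image_cover_regular : forall (X Y : hp_lex) (f : hom X Y),
    regular_epi (image_cover f);
  regular_epi_stable : forall (X Y Z : hp_lex) (e : hom X Y) (f : hom Z Y),
    regular_epi e -> regular_epi (pb1 f e);
  (* equivalence relations are kernel pairs *)
  effective : forall (X : hp_lex) (R : sub (prod X X)), equivalence R ->
    exists (Y : hp_lex) (q : hom X Y),
      is_pullback (pr1 ∘ sub_map R) (pr2 ∘ sub_map R) q q;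
  (* finite sums *)
  zero : hp_lex;
  cobang : forall X : hp_lex, hom zero X;
  cobang_uniq : forall (X : hp_lex) (f g : hom zero X), f = g;
  zero_stable : forall (X : hp_lex) (f : hom X zero), iso f;
  sum : hp_lex -> hp_lex -> hp_lex;
  inl : forall A B : hp_lex, hom A (sum A B);
  inr : forall A B : hp_lex, hom B (sum A B);
  copair : forall (A B T : hp_lex) (u : hom A T) (v : hom B T), hom (sum A B) T;
  copair_inl : forall (A B T : hp_lex) (u : hom A T) (v : hom B T),
    copair u v ∘ inl A B = u;
  copair_inr : forall (A B T : hp_lex) (u : hom A T) (v : hom B T),
    copair u v ∘ inr A B = v;
  copair_uniq : forall (A B T : hp_lex) (h k : hom (sum A B) T),
    h ∘ inl A B = k ∘ inl A B -> h ∘ inr A B = k ∘ inr A B -> h = k;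
  inl_mono : forall A B : hp_lex, mono (inl A B);
  inr_mono : forall A B : hp_lex, mono (inr A B);
  sum_disjoint : forall A B : hp_lex,
    is_pullback (cobang A) (cobang B) (inl A B) (inr A B);
  sum_stable : forall (A B Z : hp_lex) (f : hom Z (sum A B)),
    is_coproduct (pb1 f (inl A B)) (pb1 f (inr A B));
  (* universal quantification *)
  sub_all : forall (X Y : hp_lex) (f : hom X Y), sub X -> sub Y;
  sub_all_adj : forall (X Y : hp_lex) (f : hom X Y) (A : sub X) (B : sub Y),
    sub_le B (sub_all f A) <-> sub_le (sub_pull f B) A
}.
Arguments zero {_}.
Arguments cobang {_} _.

Section SubobjectLogic.
Variable C : heyting_pretopos.

Definition sub_bot (X : C) : sub X := image (cobang X).
Definition sub_or (X : C) (A B : sub X) : sub X :=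
  image (copair (sub_map A) (sub_map B)).
Definition sub_imp (X : C) (A B : sub X) : sub X :=
  sub_all (sub_map A) (sub_pull (sub_map A) B).
Definition sub_ex (X Y : C) (f : hom X Y) (A : sub X) : sub Y :=
  image (f ∘ sub_map A).

Definition boolean : Prop :=
  forall (X : C) (A : sub X), exists B : sub X,
    sub_le (sub_and A B) (sub_bot X) /\ sub_le (sub_top X) (sub_or A B).

End SubobjectLogic.

(* A natural number object with parameters. *)
Record nno (C : lexcat) := NNO {
  nno_ob :> C;
  nno_zero : hom one nno_ob;
  nno_succ : hom nno_ob nno_ob;
  nno_rec : forall (P Y : C) (f : hom P Y) (t : hom (prod P Y) Y),
    exists! fbar : hom (prod P nno_ob) Y,
      fbar ∘ pair (idm P) (nno_zero ∘ bang P) = f /\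
      fbar ∘ prodmap (idm P) nno_succ = t ∘ pair pr1 fbar
}.

(** * Slice categories *)

Section Slice.
Variables (C : lexcat) (B : C).

Record slice_ob := SliceOb { s_dom : C; s_map : hom s_dom B }.
Record slice_hom (X Y : slice_ob) := SliceHom {
  s_mor : hom (s_dom X) (s_dom Y);
  s_comm : s_map Y ∘ s_mor = s_map X
}.

Lemma slice_hom_eq (X Y : slice_ob) (f g : slice_hom X Y) :
  s_mor f = s_mor g -> f = g.
Proof.
destruct f as [f Hf], g as [g Hg]; simpl; intros E; subst g.
f_equal; apply proof_irrelevance.
Qed.

Lemma slice_map_comp (X Y : slice_ob) (f : slice_hom X Y) (Z : C)
    (u : hom Z (s_dom X)) : s_map X ∘ u = s_map Y ∘ (s_mor f ∘ u).
Proof. rewrite comp_assoc, s_comm; reflexivity. Qed.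

Definition slice_idm (X : slice_ob) : slice_hom X X :=
  SliceHom (comp_idr (s_map X)).

Lemma slice_comp_comm (X Y Z : slice_ob) (g : slice_hom Y Z) (f : slice_hom X Y) :
  s_map Z ∘ (s_mor g ∘ s_mor f) = s_map X.
Proof. rewrite comp_assoc, s_comm; apply s_comm. Qed.
Definition slice_comp (X Y Z : slice_ob) (g : slice_hom Y Z) (f : slice_hom X Y) :
  slice_hom X Z := SliceHom (slice_comp_comm g f).

Definition slice_cat : category.
Proof.
refine (@Category slice_ob slice_hom slice_idm slice_comp _ _ _); intros;
  apply slice_hom_eq; simpl.
- apply comp_idl.
- apply comp_idr.
- apply comp_assoc.
Defined.

Definition slice_pb (X Y Z : slice_cat) (f : hom X Z) (g : hom Y Z) : slice_cat :=
  SliceOb (s_map X ∘ pb1 (s_mor f) (s_mor g)).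
Definition slice_pb1 (X Y Z : slice_cat) (f : hom X Z) (g : hom Y Z) :
  hom (slice_pb f g) X := @SliceHom (slice_pb f g) X _ eq_refl.
Lemma slice_pb2_comm (X Y Z : slice_cat) (f : hom X Z) (g : hom Y Z) :
  s_map Y ∘ pb2 (s_mor f) (s_mor g) = s_map (slice_pb f g).
Proof.
simpl; rewrite <- (s_comm g), <- (s_comm f), <- !comp_assoc, pb_comm.
reflexivity.
Qed.
Definition slice_pb2 (X Y Z : slice_cat) (f : hom X Z) (g : hom Y Z) :
  hom (slice_pb f g) Y := @SliceHom (slice_pb f g) Y _ (slice_pb2_comm f g).
Lemma slice_pair_comm (X Y Z : slice_cat) (f : hom X Z) (g : hom Y Z)
    (T : slice_cat) (u : hom T X) (v : hom T Y) (e : f ∘ u = g ∘ v) :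
  s_map (slice_pb f g) ∘ pb_pair (f_equal (@s_mor _ _) e) = s_map T.
Proof. simpl; rewrite <- comp_assoc, pb_pair1; apply s_comm. Qed.

Definition slice : lexcat.
Proof.
refine (@Lexcat slice_cat (SliceOb (idm B))
  (fun X => @SliceHom X (SliceOb (idm B)) (s_map X) (comp_idl _)) _
  slice_pb slice_pb1 slice_pb2 _
  (fun _ _ _ f g T _ _ e => @SliceHom T (slice_pb f g) _ (slice_pair_comm e))
  _ _ _); intros; apply slice_hom_eq; simpl.
- rewrite <- (comp_idl (s_mor f)), <- (comp_idl (s_mor g)).
  exact (eq_trans (s_comm f) (eq_sym (s_comm g))).
- apply pb_comm.
- apply pb_pair1.
- apply pb_pair2.
- apply pb_uniq.
  + exact (f_equal (@s_mor _ _) H).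
  + exact (f_equal (@s_mor _ _) H0).
Defined.

(* a subobject of the underlying object, seen in the slice *)
Lemma slice_sub_mono (Y : slice) (A : sub (s_dom Y)) :
  @mono slice (SliceOb (s_map Y ∘ sub_map A)) Y
    (@SliceHom (SliceOb (s_map Y ∘ sub_map A)) Y (sub_map A) eq_refl).
Proof.
intros T u v E; apply slice_hom_eq, (@sub_mono _ _ A).
exact (f_equal (@s_mor _ _) E).
Qed.
Definition slice_sub (Y : slice) (A : sub (s_dom Y)) : sub Y :=
  Sub (@slice_sub_mono Y A).

Lemma slice_sub_in (Y : slice) (A : sub (s_dom Y)) (T : slice) (x : hom T Y) :
  sub_in (slice_sub A) x <-> sub_in A (s_mor x).
Proof.
split.
- intros [h Hh]; exists (s_mor h); exact (f_equal (@s_mor _ _) Hh).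
- intros [h Hh].
  assert (E : s_map (sub_ob (slice_sub A)) ∘ h = s_map T).
  { simpl; rewrite <- comp_assoc, Hh; apply s_comm. }
  exists (@SliceHom T (sub_ob (slice_sub A)) h E); apply slice_hom_eq; exact Hh.
Qed.

End Slice.

(** * Powerclass objects and coalgebras *)

(* A class of arrows of [C]. *)
Definition arrows (C : category) := forall X Y : C, hom X Y -> Prop.

(* The induced class of arrows on a slice. *)
Definition slice_arrows (C : lexcat) (S : arrows C) (B : C) : arrows (slice B) :=
  fun X Y f => S _ _ (s_mor f).

Section Powerclass.
Variables (C : lexcat) (S : arrows C).

Definition small_rel (I X : C) (R : sub (prod I X)) : Prop :=
  S (pr1 ∘ sub_map R).

(* An object with a bijection, natural in [I], between the maps from [I] to it
   and the small relations between [I] and [X] (up to equality of subobjects). *)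
Record powerclass (X : C) := Powerclass {
  pow_ob :> C;
  pow_rel : forall I : C, hom I pow_ob -> sub (prod I X);
  pow_small : forall (I : C) (f : hom I pow_ob), small_rel (pow_rel f);
  pow_nat : forall (I J : C) (f : hom I pow_ob) (g : hom J I),
    sub_eq (pow_rel (f ∘ g)) (sub_pull (prodmap g (idm X)) (pow_rel f));
  pow_inj : forall (I : C) (f g : hom I pow_ob),
    sub_eq (pow_rel f) (pow_rel g) -> f = g;
  pow_surj : forall (I : C) (R : sub (prod I X)), small_rel R ->
    exists f : hom I pow_ob, sub_eq (pow_rel f) R
}.

Definition pow_mem (X : C) (P : powerclass X) : sub (prod P X) :=
  pow_rel (idm (pow_ob P)).

(* [h] is the action of the covariant powerclass functor on [f]: the relation
   it names is the image of the membership relation under [id x f].  Images are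
   epi-mono factorizations, since every epi of a pretopos is regular. *)
Definition pow_map (X Y : C) (PX : powerclass X) (PY : powerclass Y)
    (f : hom X Y) (h : hom PX PY) : Prop :=
  exists e : hom (pow_mem PX) (pow_rel h),
    epi e /\
    sub_map (pow_rel h) ∘ e = prodmap (idm (pow_ob PX)) f ∘ sub_map (pow_mem PX).

(* Powerclass objects are unique up to unique isomorphism only, so that each
   coalgebra carries the powerclass object in which its structure map lands. *)
Record coalgebra := Coalgebra {
  coalg_ob :> C;
  coalg_pow : powerclass coalg_ob;
  coalg_map : hom coalg_ob coalg_pow
}.

Definition coalg_mor (A B : coalgebra) (f : hom A B) : Prop :=
  exists h : hom (coalg_pow A) (coalg_pow B),
    pow_map f h /\ h ∘ coalg_map A = coalg_map B ∘ f.

Definition terminal_coalgebra (B : coalgebra) : Prop :=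
  forall A : coalgebra, exists! f : hom A B, coalg_mor f.

End Powerclass.

(** ** Reindexing of coalgebras *)

Section Reindex.
Variables (C : lexcat) (S : arrows C) (I : C).

(* [I^* X] *)
Definition reindex (X : C) : slice I := @SliceOb C I (prod I X) pr1.

Lemma reindex_map_comm (X Y : C) (f : hom X Y) :
  s_map (reindex Y) ∘ prodmap (idm I) f = s_map (reindex X).
Proof. simpl; unfold prodmap; rewrite pr1_pair; apply comp_idl. Qed.
Definition reindex_map (X Y : C) (f : hom X Y) :
  @hom (slice I) (reindex X) (reindex Y) :=
  @SliceHom C I (reindex X) (reindex Y) _ (reindex_map_comm f).

Variable X : C.

(* For [T] over [I], the product of [T] and [I^* X] in the slice is [T x X]. *)
Lemma reindex_prod_comm (T : slice I) :
  s_map T ∘ @pr1 C (s_dom T) X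
  = s_map (reindex X) ∘ pair (s_map T ∘ pr1) pr2.
Proof. simpl; rewrite pr1_pair; reflexivity. Qed.
Definition reindex_prod (T : slice I) :
    hom (prod (s_dom T) X) (s_dom (prod T (reindex X))) :=
  pb_pair (reindex_prod_comm T).
Definition reindex_prod_inv (T : slice I) :
    hom (s_dom (prod T (reindex X))) (prod (s_dom T) X) :=
  pair (s_mor (@pr1 (slice I) T (reindex X)))
       (pr2 ∘ s_mor (@pr2 (slice I) T (reindex X))).

Lemma reindex_prod1 (T : slice I) :
  s_mor (@pr1 (slice I) T (reindex X)) ∘ reindex_prod T = pr1.
Proof. exact (pb_pair1 (reindex_prod_comm T)). Qed.
Lemma reindex_prod2 (T : slice I) :
  s_mor (@pr2 (slice I) T (reindex X)) ∘ reindex_prod T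
  = pair (s_map T ∘ pr1) pr2.
Proof. exact (pb_pair2 (reindex_prod_comm T)). Qed.

Lemma reindex_prodK (T : slice I) :
  reindex_prod_inv T ∘ reindex_prod T = idm _.
Proof.
unfold reindex_prod_inv; apply prod_uniq; rewrite comp_assoc, comp_idr.
- rewrite pr1_pair; apply reindex_prod1.
- rewrite pr2_pair, <- comp_assoc, reindex_prod2; apply pr2_pair.
Qed.
Lemma reindex_prodVK (T : slice I) :
  reindex_prod T ∘ reindex_prod_inv T = idm _.
Proof.
apply pb_uniq; rewrite comp_assoc, comp_idr.
- refine (eq_trans (f_equal (fun z => z ∘ _) (reindex_prod1 T)) _).
  apply pr1_pair.
- refine (eq_trans (f_equal (fun z => z ∘ _) (reindex_prod2 T)) _).
  apply prod_uniq; rewrite comp_assoc.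
  + refine (eq_trans (f_equal (fun z => z ∘ _) (pr1_pair _ _)) _).
    unfold reindex_prod_inv; rewrite <- comp_assoc, pr1_pair; apply pb_comm.
  + refine (eq_trans (f_equal (fun z => z ∘ _) (pr2_pair _ _)) _).
    apply pr2_pair.
Qed.

Lemma reindex_prodVK_comp (T : slice I) (Z : C)
    (x : hom Z (s_dom (prod T (reindex X)))) :
  reindex_prod T ∘ (reindex_prod_inv T ∘ x) = x.
Proof.
refine (eq_trans (comp_assoc _ _ _) _).
refine (eq_trans (f_equal (fun z => z ∘ x) (reindex_prodVK T)) _).
apply comp_idl.
Qed.

Lemma reindex_prod_mono (T : slice I) : mono (reindex_prod T).
Proof.
intros Z u v E.
rewrite <- (comp_idl u), <- (comp_idl v), <- reindex_prodK, <- !comp_assoc, E.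
reflexivity.
Qed.

(* A relation between the domain of [T] and [X], as a relation in the slice. *)
Definition reindex_rel (T : slice I) (R : sub (prod (s_dom T) X)) :
    sub (prod T (reindex X)) :=
  @slice_sub C I (prod T (reindex X))
    (Sub (comp_mono (@reindex_prod_mono T) (@sub_mono _ _ R))).

Lemma reindex_rel_in (T : slice I) (R : sub (prod (s_dom T) X))
    (Z : slice I) (x : hom Z (prod T (reindex X))) :
  sub_in (reindex_rel R) x <-> sub_in R (reindex_prod_inv T ∘ s_mor x).
Proof.
unfold reindex_rel; rewrite slice_sub_in; split; intros [h Hh]; exists h.
- refine (eq_trans _ (f_equal (fun z => reindex_prod_inv T ∘ z) Hh)).
  refine (eq_trans _ (eq_sym (comp_assoc _ _ _))).
  refine (f_equal (fun z => z ∘ h) _); simpl.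
  rewrite comp_assoc, reindex_prodK, comp_idl; reflexivity.
- refine (eq_trans (eq_sym (comp_assoc _ _ _)) _).
  refine (eq_trans (f_equal (fun z => reindex_prod T ∘ z) Hh) _).
  apply reindex_prodVK_comp.
Qed.

Lemma reindex_rel_le (T : slice I) (R R' : sub (prod (s_dom T) X)) :
  sub_le (reindex_rel R) (reindex_rel R') <-> sub_le R R'.
Proof.
rewrite !sub_leP; split; intros H Z x Hx.
- pose (Z' := @SliceOb C I Z (s_map (prod T (reindex X)) ∘ (reindex_prod T ∘ x))).
  pose (x' := @SliceHom C I Z' (prod T (reindex X)) (reindex_prod T ∘ x) eq_refl).
  specialize (H Z' x'); rewrite !reindex_rel_in in H; simpl in H.
  rewrite comp_assoc, reindex_prodK, comp_idl in H; exact (H Hx).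
- rewrite reindex_rel_in in *; exact (H _ _ Hx).
Qed.

Variable P : powerclass S X.

Lemma reindex_pow_small (T : slice I) (f : hom T (reindex P)) :
  small_rel (slice_arrows S (B:=I)) (reindex_rel (pow_rel (pr2 ∘ s_mor f))).
Proof.
unfold small_rel, slice_arrows; simpl; rewrite comp_assoc.
rewrite reindex_prod1; apply pow_small.
Qed.

Lemma reindex_pow_nat (T U : slice I) (f : hom T (reindex P)) (g : hom U T) :
  sub_eq (reindex_rel (pow_rel (pr2 ∘ s_mor (f ∘ g))))
    (sub_pull (prodmap g (idm (reindex X)))
       (reindex_rel (pow_rel (pr2 ∘ s_mor f)))).
Proof.
assert (K : forall (Z : slice I) (x : hom Z (prod U (reindex X))),
  sub_in (reindex_rel (pow_rel (pr2 ∘ s_mor (f ∘ g)))) x <->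
  sub_in (sub_pull (prodmap g (idm (reindex X)))
       (reindex_rel (pow_rel (pr2 ∘ s_mor f)))) x).
{ intros Z x; rewrite sub_in_pull, !reindex_rel_in.
  change (s_mor (f ∘ g)) with (s_mor f ∘ s_mor g); rewrite comp_assoc.
  destruct (pow_nat (pr2 ∘ s_mor f) (s_mor g)) as [H1 H2].
  rewrite sub_leP in H1, H2.
  assert (E : prodmap (s_mor g) (idm X) ∘ (reindex_prod_inv U ∘ s_mor x)
    = reindex_prod_inv T ∘ s_mor (prodmap g (idm (reindex X)) ∘ x)).
  { change (s_mor (prodmap g (idm (reindex X)) ∘ x))
      with (s_mor (prodmap g (idm (reindex X))) ∘ s_mor x).
    rewrite !comp_assoc; f_equal.
    unfold prodmap at 1, reindex_prod_inv; apply prod_uniq; rewrite !comp_assoc.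
    - rewrite !pr1_pair, <- comp_assoc, pr1_pair.
      exact (eq_sym (f_equal (@s_mor _ _ _ _)
        (pr1_pair (g ∘ pr1) (idm (reindex X) ∘ pr2)))).
    - rewrite !pr2_pair, <- !comp_assoc, pr2_pair, comp_idl; f_equal.
      transitivity (s_mor (idm (reindex X) ∘ @pr2 (slice I) U (reindex X))).
      + symmetry; apply comp_idl.
      + exact (eq_sym (f_equal (@s_mor _ _ _ _)
        (pr2_pair (g ∘ pr1) (idm (reindex X) ∘ pr2)))). }
  rewrite <- E; refine (iff_trans _ (sub_in_pull _ _ _)).
  split; [apply H1 | apply H2]. }
split; rewrite sub_leP; intros Z x; apply K.
Qed.

Lemma reindex_pow_inj (T : slice I) (f g : hom T (reindex P)) :
  sub_eq (reindex_rel (pow_rel (pr2 ∘ s_mor f)))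
    (reindex_rel (pow_rel (pr2 ∘ s_mor g))) -> f = g.
Proof.
unfold sub_eq; rewrite !reindex_rel_le; intros H.
apply slice_hom_eq, prod_uniq.
- exact (eq_trans (s_comm f) (eq_sym (s_comm g))).
- exact (pow_inj H).
Qed.

Lemma reindex_pow_surj (T : slice I) (R : sub (prod T (reindex X))) :
  small_rel (slice_arrows S (B:=I)) R ->
  exists f : hom T (reindex P),
    sub_eq (reindex_rel (pow_rel (pr2 ∘ s_mor f))) R.
Proof.
intros HR.
assert (M : mono (reindex_prod_inv T ∘ s_mor (sub_map R))).
{ intros Z u v E.
  assert (E' : s_mor (sub_map R) ∘ u = s_mor (sub_map R) ∘ v).
  { rewrite <- (reindex_prodVK_comp (s_mor (sub_map R) ∘ u)),
      <- (reindex_prodVK_comp (s_mor (sub_map R) ∘ v)).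
    apply f_equal; rewrite !comp_assoc; exact E. }
  pose (Z' := @SliceOb C I Z (s_map (sub_ob R) ∘ u)).
  assert (Ev : s_map (sub_ob R) ∘ v = s_map Z').
  { simpl; rewrite !(slice_map_comp (sub_map R)), E'; reflexivity. }
  pose (u' := @SliceHom C I Z' (sub_ob R) u eq_refl).
  pose (v' := @SliceHom C I Z' (sub_ob R) v Ev).
  assert (Euv : u' = v').
  { apply (@sub_mono _ _ R), slice_hom_eq; exact E'. }
  exact (f_equal (@s_mor _ _ _ _) Euv). }
pose (R' := Sub M).
assert (HR' : small_rel S R').
{ unfold small_rel; simpl; rewrite comp_assoc; unfold reindex_prod_inv.
  rewrite pr1_pair; exact HR. }
destruct (pow_surj P HR') as [f0 Hf0].
assert (Ef : s_map (reindex P) ∘ pair (s_map T) f0 = s_map T)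
  by apply pr1_pair.
exists (@SliceHom C I T (reindex P) (pair (s_map T) f0) Ef).
assert (K : forall (Z : slice I) (x : hom Z (prod T (reindex X))),
  sub_in (reindex_rel R') x <-> sub_in R x).
{ intros Z x; rewrite reindex_rel_in; split; intros [h Hh].
  - simpl in Hh; rewrite <- comp_assoc in Hh.
    assert (Hh' : s_mor (sub_map R) ∘ h = s_mor x).
    { refine (eq_trans _ (reindex_prodVK_comp (s_mor x))).
      refine (eq_trans (eq_sym (reindex_prodVK_comp _)) _).
      exact (f_equal (fun z => reindex_prod T ∘ z) Hh). }
    assert (Eh : s_map (sub_ob R) ∘ h = s_map Z).
    { rewrite (slice_map_comp (sub_map R)), Hh'; apply s_comm. }
    exists (@SliceHom C I Z (sub_ob R) h Eh); apply slice_hom_eq; exact Hh'.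
  - exists (s_mor h); simpl; rewrite <- comp_assoc; f_equal.
    exact (f_equal (@s_mor _ _ _ _) Hh). }
simpl; rewrite pr2_pair; destruct Hf0 as [H1 H2].
apply <- reindex_rel_le in H1; apply <- reindex_rel_le in H2.
rewrite sub_leP in H1, H2.
split; rewrite sub_leP; intros Z x Hx.
- apply K, H1, Hx.
- apply H2, K, Hx.
Qed.

(* [I^* (P_s X)] is a powerclass object of [I^* X] in the slice over [I]. *)
Definition reindex_powerclass : powerclass (slice_arrows S (B:=I)) (reindex X) :=
  Powerclass reindex_pow_small reindex_pow_nat reindex_pow_inj reindex_pow_surj.

End Reindex.

(* [I^* (V, E)] *)
Definition reindex_coalgebra (C : lexcat) (S : arrows C) (I : C)
    (V : coalgebra S) : coalgebra (slice_arrows S (B:=I)) :=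
  @Coalgebra _ _ (reindex I V) (reindex_powerclass I (coalg_pow V))
    (reindex_map I (coalg_map V)).

Definition indexed_final_coalgebra (C : lexcat) (S : arrows C)
    (V : coalgebra S) : Prop :=
  forall I : C, terminal_coalgebra (reindex_coalgebra I V).

(** * Small maps *)

Section SmallMaps.
Variables (C : heyting_pretopos) (S : arrows C).

Record small_maps (N : nno C) : Prop := SmallMaps {
  small_id : forall X : C, S (idm X);
  small_comp : forall (X Y Z : C) (g : hom Y Z) (f : hom X Y),
    S g -> S f -> S (g ∘ f);
  small_pullback : forall (P A B D : C)
    (p : hom P A) (q : hom P B) (f : hom A D) (g : hom B D),
    is_pullback p q f g -> S g -> S p;
  small_diag : forall X : C, S (diag X);
  small_quotient : forall (X D A : C) (e : hom X D) (g : hom D A),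
    epi e -> S (g ∘ e) -> S g;
  small_copair : forall (X D A : C) (f : hom X A) (g : hom D A),
    S f -> S g -> S (copair f g);
  small_powerclass : forall X : C, inhabited (powerclass S X);
  small_nno : S (bang N);
  (* a universal small map [pi] *)
  small_universal : exists (E U : C) (pi : hom E U), S pi /\
    forall (A B : C) (f : hom A B), S f ->
      exists (B' : C) (q : hom B' B) (u : hom B' U), epi q /\
        exists i : hom (pb q f) (pb u pi), iso i /\ pb1 u pi ∘ i = pb1 q f
}.

Definition axiom_P2 : Prop :=
  forall (B : C) (X : slice B), S (s_map X) ->
  forall PX : powerclass (slice_arrows S (B:=B)) X, S (s_map (pow_ob PX)).

Definition axiom_M : Prop :=
  forall (X Y : C) (m : hom X Y), mono m -> S m.

Definition axiom_C : Prop :=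
  forall (Y X A : C) (p : hom Y X) (f : hom X A), epi p -> S f ->
  exists (Z B : C) (k : hom Z Y) (g : hom Z B) (h : hom B A),
    epi h /\ S g /\ quasi_pullback (p ∘ k) g f h.

End SmallMaps.

(** * The language of set theory *)

(* Well-scoped de Bruijn syntax: [form n] is the type of formulas with free
   variables among [n], the most recently bound variable being [F1]. *)
Inductive term (n : nat) : Type :=
| Var : Fin.t n -> term n
| Omega : term n.
Arguments Omega {n}.

Inductive form : nat -> Type :=
| Bot n : form n
| Eq n : term n -> term n -> form n
| Mem n : term n -> term n -> form n
| And n : form n -> form n -> form n
| Or n : form n -> form n -> form n
| Imp n : form n -> form n -> form n
| All n : form (S n) -> form n
| Ex n : form (S n) -> form n.
Arguments Bot {n}.

Definition scons (T : Type) (n : nat) (x : T) (f : Fin.t n -> T) :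
  Fin.t (S n) -> T := fun i => Fin.caseS' i (fun _ => T) x f.

Definition ren_term m n (r : Fin.t m -> Fin.t n) (t : term m) : term n :=
  match t with Var i => Var (r i) | Omega => Omega end.

Definition upren m n (r : Fin.t m -> Fin.t n) : Fin.t (S m) -> Fin.t (S n) :=
  scons F1 (fun i => FS (r i)).

Fixpoint ren m (phi : form m) : forall n, (Fin.t m -> Fin.t n) -> form n :=
  match phi with
  | Bot => fun n r => Bot
  | Eq t u => fun n r => Eq (ren_term r t) (ren_term r u)
  | Mem t u => fun n r => Mem (ren_term r t) (ren_term r u)
  | And a b => fun n r => And (ren a r) (ren b r)
  | Or a b => fun n r => Or (ren a r) (ren b r)
  | Imp a b => fun n r => Imp (ren a r) (ren b r)
  | All a => fun n r => All (ren a (upren r))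
  | Ex a => fun n r => Ex (ren a (upren r))
  end.

Definition lift n (t : term n) : term (S n) := ren_term FS t.
Notation "↑ t" := (lift t) (at level 9, right associativity, t at level 9)
  : cat_scope.

Definition v0 {n} : term (S n) := Var F1.
Definition v1 {n} : term (S (S n)) := Var (FS F1).
Definition v2 {n} : term (S (S (S n))) := Var (FS (FS F1)).
Definition v3 {n} : term (S (S (S (S n)))) := Var (FS (FS (FS F1))).

Definition Neg n (phi : form n) : form n := Imp phi Bot.
Definition Iff n (phi psi : form n) : form n := And (Imp phi psi) (Imp psi phi).
Definition AllIn n (t : term n) (phi : form (S n)) : form n :=
  All (Imp (Mem v0 ↑t) phi).
Definition ExIn n (t : term n) (phi : form (S n)) : form n :=
  Ex (And (Mem v0 ↑t) phi).
Definition ExU n (phi : form (S n)) : form n :=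
  Ex (And phi (All (Imp (ren phi (scons F1 (fun i => FS (FS i)))) (Eq v0 v1)))).

(* universal closure *)
Fixpoint closure n : form n -> form 0 :=
  match n with
  | 0 => fun phi => phi
  | S m => fun phi => closure (All phi)
  end.

Definition is_empty n (t : term n) : form n := All (Iff (Mem v0 ↑t) Bot).
(* [t = s u], where [s u] is the union of [u] and [{u}] *)
Definition is_succ n (t u : term n) : form n :=
  All (Iff (Mem v0 ↑t) (Or (Mem v0 ↑u) (Eq v0 ↑u))).
Definition is_upair n (t a b : term n) : form n :=
  All (Iff (Mem v0 ↑t) (Or (Eq v0 ↑a) (Eq v0 ↑b))).
(* Kuratowski pairs *)
Definition is_pair n (t a b : term n) : form n :=
  All (Iff (Mem v0 ↑t) (Or (is_upair v0 ↑a ↑a) (is_upair v0 ↑a ↑b))).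
Definition pair_in n (a b t : term n) : form n :=
  Ex (And (is_pair v0 ↑a ↑b) (Mem v0 ↑t)).

(** ** The theories *)

Definition Extensionality : form 2 :=
  Imp (All (Iff (Mem v0 v2) (Mem v0 v1))) (Eq v1 v0).
Definition Pairing : form 2 :=
  Ex (All (Iff (Mem v0 v1) (Or (Eq v0 v3) (Eq v0 v2)))).
Definition Union : form 1 :=
  Ex (All (Iff (Mem v0 v1) (Ex (And (Mem v1 v0) (Mem v0 v3))))).
Definition Emptyset : form 0 := Ex (is_empty v0).
Definition Intersection : form 2 :=
  Ex (All (Iff (Mem v0 v1) (And (Mem v0 v3) (Mem v0 v2)))).
(* In [phi], the variable [F1] is y, [FS F1] is x, and the others are those of
   the context; on the right-hand side x is bound inside y, which is bound
   inside z. *)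
Definition Replacement n (a : Fin.t n) (phi : form (S (S n))) : form n :=
  Imp (AllIn (Var a) (ExU phi))
    (Ex (All (Iff (Mem v0 v1)
       (ExIn ↑↑(Var a)
          (ren phi (scons (FS F1) (scons F1 (fun i => FS (FS (FS i)))))))))).
Definition Infinity1 : form 0 :=
  And (Ex (And (is_empty v0) (Mem v0 Omega)))
      (AllIn Omega (Ex (And (is_succ v0 v1) (Mem v0 Omega)))).
(* In [psi], the variable [F1] is the induction variable. *)
Definition Infinity2 n (psi : form (S n)) : form n :=
  Imp (And (Ex (And (is_empty v0) psi))
           (AllIn Omega (Imp psi
              (Ex (And (is_succ v0 v1)
                       (ren psi (scons F1 (fun i => FS (FS i)))))))))
      (AllIn Omega psi).

Inductive CZF0 : form 0 -> Prop :=
| CZF0_extensionality : CZF0 (closure Extensionality)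
| CZF0_pairing : CZF0 (closure Pairing)
| CZF0_union : CZF0 (closure Union)
| CZF0_emptyset : CZF0 Emptyset
| CZF0_intersection : CZF0 (closure Intersection)
| CZF0_replacement n (a : Fin.t n) (phi : form (S (S n))) :
    CZF0 (closure (Replacement a phi))
| CZF0_infinity1 : CZF0 Infinity1
| CZF0_infinity2 n (psi : form (S n)) : CZF0 (closure (Infinity2 psi)).

Definition Powerset : form 1 :=
  Ex (All (Iff (Mem v0 v1) (AllIn v0 (Mem v0 v3)))).
(* In [phi], the variable [F1] is z; the variable y is skipped. *)
Definition Separation n (x : Fin.t n) (phi : form (S n)) : form n :=
  Ex (All (Iff (Mem v0 v1)
     (And (Mem v0 ↑↑(Var x)) (ren phi (scons F1 (fun i => FS (FS i))))))).
(* In [phi], the variable [F1] is w and [FS F1] is y. *)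
Definition Collection n (x : Fin.t n) (phi : form (S (S n))) : form n :=
  Imp (AllIn (Var x) (Ex phi))
    (Ex (AllIn ↑(Var x) (ExIn v1
       (ren phi (scons F1 (scons (FS F1) (fun i => FS (FS (FS i))))))))).

Inductive IZFm : form 0 -> Prop :=
| IZFm_CZF0 phi : CZF0 phi -> IZFm phi
| IZFm_powerset : IZFm (closure Powerset)
| IZFm_separation n (x : Fin.t n) (phi : form (S n)) :
    IZFm (closure (Separation x phi))
| IZFm_collection n (x : Fin.t n) (phi : form (S (S n))) :
    IZFm (closure (Collection x phi)).

Definition ExcludedMiddle n (phi : form n) : form n := Or phi (Neg phi).

Inductive ZFm : form 0 -> Prop :=
| ZFm_IZFm phi : IZFm phi -> ZFm phi
| ZFm_excluded_middle n (phi : form n) : ZFm (closure (ExcludedMiddle phi)).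

Definition is_graph k (n e : term k) : form k :=
  AllIn e (ExIn ↑n (ExIn ↑↑n (is_pair v2 v1 v0))).
(* [c] is a function with domain [n] *)
Definition is_function k (c n : term k) : form k :=
  And (AllIn c (ExIn ↑n (Ex (is_pair v2 v1 v0))))
      (AllIn n (ExU (pair_in v1 v0 ↑↑c))).
(* for x in n and u = c(x): w is in u iff w = c(y) for some (x, y) in e *)
Definition is_colouring k (c n e : term k) : form k :=
  And (is_function c n)
      (AllIn n (All (Imp (pair_in v1 v0 ↑↑c)
         (All (Iff (Mem v0 v1)
            (Ex (And (pair_in v3 v0 ↑↑↑↑e) (pair_in v0 v1 ↑↑↑↑c)))))))).
Definition AFA : form 0 :=
  All (All (Imp (is_graph v1 v0) (ExU (is_colouring v0 v2 v1)))).

(** * Interpretation in the internal logic *)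

Section Interpretation.
Variables (C : heyting_pretopos) (S : arrows C) (V : coalgebra S).
Variable w : hom one (coalg_ob V).

Fixpoint ctx (n : nat) : C :=
  match n with 0 => one | Datatypes.S m => prod (ctx m) V end.

Fixpoint proj n (i : Fin.t n) : hom (ctx n) V :=
  match i with F1 => pr2 | FS j => proj j ∘ pr1 end.

Definition interp_term n (t : term n) : hom (ctx n) V :=
  match t with Var i => proj i | Omega => w ∘ bang (ctx n) end.

Fixpoint interp n (phi : form n) : sub (ctx n) :=
  match phi with
  | Bot => sub_bot _
  | Eq t u => sub_pull (pair (interp_term t) (interp_term u)) (sub_diag _)
  | Mem t u =>
      sub_pull (pair (coalg_map V ∘ interp_term u) (interp_term t))
        (pow_mem (coalg_pow V))
  | And a b => sub_and (interp a) (interp b)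
  | Or a b => sub_or (interp a) (interp b)
  | Imp a b => sub_imp (interp a) (interp b)
  | All a => sub_all pr1 (interp a)
  | Ex a => sub_ex pr1 (interp a)
  end.

Definition valid (phi : form 0) : Prop := sub_le (sub_top _) (interp phi).

End Interpretation.

(* Main.v *)
From Stdlib Require Import ssreflect Fin FunctionalExtensionality.
Require Import Defs.

Set Implicit Arguments.
Unset Strict Implicit.
Unset Printing Implicit Defensive.

(** The internal logic is unfolded by Kripke-Joyal semantics for the topology
    of [C] generated by regular epis and finite sums: [forces phi rho] says what
    the formula [phi] means for generalized elements [rho] of [V] at a stage
    [T], and [forces_interp] identifies it with membership of the tuple [rho]
    in the subobject [interp phi].  The theorem is then a list of statements on
    generalized elements, in which an existential quantifier is witnessed on a
    cover ([locally]).

    The structure map [E : V -> P_s V] of a final coalgebra is invertible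
    ([lambek]), so a generalized element of [V] is the same thing as a small
    family of elements of [V].  Concretely, every span from [T] to [V] whose
    leg to [T] is small names a set [T -> V], whose elements are locally the
    values of the span ([small_set]), and sets with the same elements at all
    later stages are equal ([mem_ext]).  Each closure property of small maps
    thereby becomes an operation on sets.  Sums give pairing, composition gives
    union, and smallness of the natural numbers gives infinity.  Because monos
    are small, any subobject of the elements of a set forms a set: this is full
    separation.  A functional relation on the elements of a set is a map, by
    unique choice ([glue]), hence replacement.  The collection property of
    small maps turns the cover on which witnesses exist into a small family of
    witnesses.  For the power set of [a], the pairs [(t, x)] with [x] included
    in [a(t)] form, over [T], a powerclass of the elements of [a], so they are
    a small family over [T] by the stability of small maps under powerclasses.

    Anti-foundation is finality.  A graph [(n, e)] at a stage [T] is a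
    coalgebra on the object of elements of [n]: the set of successors of a node
    is a small family.  Its unique morphism to [V] is the unique decoration of
    the graph ([decoration]); Kuratowski pairs translate between this map and
    a set-theoretic function.  Excluded middle holds because subobjects
    have complements. *)

(** * Calculus of finite limits *)

Section Calculus.
Variable C : lexcat.

Lemma pr1_pairK (T A B W : C) (u : hom T A) (v : hom T B) (w : hom W T) :
  pr1 ∘ (pair u v ∘ w) = u ∘ w.
Proof. by rewrite comp_assoc pr1_pair. Qed.
Lemma pr2_pairK (T A B W : C) (u : hom T A) (v : hom T B) (w : hom W T) :
  pr2 ∘ (pair u v ∘ w) = v ∘ w.
Proof. by rewrite comp_assoc pr2_pair. Qed.
Lemma pair_comp (T A B W : C) (u : hom T A) (v : hom T B) (w : hom W T) :
  pair u v ∘ w = pair (u ∘ w) (v ∘ w).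
Proof. by apply: prod_uniq; rewrite comp_assoc ?pr1_pair ?pr2_pair. Qed.
Lemma pair_eta (T A B : C) (x : hom T (prod A B)) : pair (pr1 ∘ x) (pr2 ∘ x) = x.
Proof. by apply: prod_uniq; rewrite ?pr1_pair ?pr2_pair. Qed.
Lemma pair_inj (T A B : C) (u u' : hom T A) (v v' : hom T B) :
  pair u v = pair u' v' -> u = u' /\ v = v'.
Proof.
move=> e; split.
- by rewrite -(pr1_pair u v) e pr1_pair.
- by rewrite -(pr2_pair u v) e pr2_pair.
Qed.
Lemma prodmap_pair (T A B A' B' : C) (f : hom A A') (g : hom B B')
    (u : hom T A) (v : hom T B) : prodmap f g ∘ pair u v = pair (f ∘ u) (g ∘ v).
Proof. by rewrite /prodmap pair_comp -!comp_assoc pr1_pair pr2_pair. Qed.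

Lemma sub_in_comp (X : C) (A : sub X) (T U : C) (x : hom T X) (f : hom U T) :
  sub_in A x -> sub_in A (x ∘ f).
Proof. by case=> h <-; exists (h ∘ f); rewrite comp_assoc. Qed.

Lemma sub_in_map (X : C) (A : sub X) : sub_in A (sub_map A).
Proof. by exists (idm _); rewrite comp_idr. Qed.

Lemma regular_epi_epi (X Y : C) (e : hom X Y) : regular_epi e -> epi e.
Proof.
move=> [K [a [b [E H]]]] T u v uv.
have /H [k [_ kU]] : (u ∘ e) ∘ a = (u ∘ e) ∘ b by rewrite -!comp_assoc E.
by rewrite -(kU u) // -(kU v).
Qed.

End Calculus.

(* Normal form: composites associated to the right, pairings outermost. *)
Create HintDb cat.
#[export] Hint Rewrite <- comp_assoc : cat.
#[export] Hint Rewrite comp_idl comp_idr pr1_pair pr2_pair pr1_pairK pr2_pairK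
  pair_comp prodmap_pair : cat.
Ltac cat := autorewrite with cat.

(** * Local truth *)

Section Local.
Variable C : heyting_pretopos.

(** Truth on some finite cover of [T], for the topology generated by regular
    epis, binary sums and the empty cover of initial objects.  A sum
    decomposition enters as a map into a sum, since this form restricts along
    any map into [T]. *)
Inductive locally : forall T : C, (forall U : C, hom U T -> Prop) -> Prop :=
| loc_here T (P : forall U : C, hom U T -> Prop) : P T (idm T) -> locally P
| loc_cover T (P : forall U : C, hom U T -> Prop) (U : C) (e : hom U T) :
    regular_epi e -> locally (fun W (g : hom W U) => P W (e ∘ g)) -> locally P
| loc_sum T (P : forall U : C, hom U T -> Prop) (A B : C) (z : hom T (sum A B)) :
    locally (fun W g => P W (pb1 z (inl A B) ∘ g)) ->
    locally (fun W g => P W (pb1 z (inr A B) ∘ g)) -> locally P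
| loc_zero T (P : forall U : C, hom U T -> Prop) : hom T zero -> locally P.

Lemma loc_mono (T : C) (P Q : forall U : C, hom U T -> Prop) :
  locally P -> (forall U f, P U f -> Q U f) -> locally Q.
Proof.
move=> H; elim: H Q => {T P}.
- by move=> T P HP Q PQ; apply: loc_here; apply: PQ.
- move=> T P U e He _ IH Q PQ; apply: (loc_cover He); apply: IH => W g; exact: PQ.
- move=> T P A B z _ IHA _ IHB Q PQ.
  by apply: (loc_sum (z := z)); [apply: IHA | apply: IHB] => W g; exact: PQ.
- by move=> T P z Q _; apply: loc_zero.
Qed.

Lemma loc_iff (T : C) (P Q : forall U : C, hom U T -> Prop) :
  (forall U f, P U f <-> Q U f) -> locally P <-> locally Q.
Proof. by move=> H; split=> L; apply: (loc_mono L) => U f /H. Qed.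

Lemma loc_bind (T : C) (P Q : forall U : C, hom U T -> Prop) :
  locally P -> (forall U f, P U f -> locally (fun W g => Q W (f ∘ g))) ->
  locally Q.
Proof.
move=> H; elim: H Q => {T P}.
- move=> T P HP Q PQ; apply: (loc_mono (PQ _ _ HP)) => U f; by rewrite comp_idl.
- move=> T P U e He _ IH Q PQ; apply: (loc_cover He); apply: IH => W g HP.
  by apply: (loc_mono (PQ _ _ HP)) => X f; rewrite comp_assoc.
- move=> T P A B z _ IHA _ IHB Q PQ.
  by apply: (loc_sum (z := z)); [apply: IHA | apply: IHB] => W g HP;
    apply: (loc_mono (PQ _ _ HP)) => X f; rewrite comp_assoc.
- by move=> T P z Q _; apply: loc_zero.
Qed.

(** Covers are stable under pullback: the sieve generated by [P] covers every
    later stage. *)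
Lemma loc_sieve (T : C) (P : forall U : C, hom U T -> Prop) : locally P ->
  forall T' (f : hom T' T), locally (fun W (g : hom W T') =>
    exists U (k : hom U T) (l : hom W U), P U k /\ f ∘ g = k ∘ l).
Proof.
elim=> {T P}.
- move=> T P HP T' f; apply: loc_here; exists T, (idm T), f; cat; by split.
- move=> T P U e He _ IH T' f.
  apply: (loc_cover (regular_epi_stable f He)).
  apply: (loc_mono (IH _ (pb2 f e))) => W g [X [k [l [HP E]]]].
  by exists X, (e ∘ k), l; split=> //; rewrite comp_assoc pb_comm -!comp_assoc E.
- have piece : forall T (P : forall U : C, hom U T -> Prop) (D S : C) (z : hom T S)
      (i : hom D S),
    (forall T' (f : hom T' (pb z i)), locally (fun W (g : hom W T') =>
      exists U (k : hom U (pb z i)) (l : hom W U),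
        P U (pb1 z i ∘ k) /\ f ∘ g = k ∘ l)) ->
    forall T' (f : hom T' T), locally (fun W (g : hom W (pb (z ∘ f) i)) =>
      exists U (k : hom U T) (l : hom W U), P U k /\ f ∘ (pb1 (z ∘ f) i ∘ g) = k ∘ l).
  { move=> T P D S z i H T' f.
    have E : z ∘ (f ∘ pb1 (z ∘ f) i) = i ∘ pb2 (z ∘ f) i.
    { by rewrite comp_assoc pb_comm. }
    apply: (loc_mono (H _ (pb_pair E))) => W g [X [k [l [HP E']]]].
    exists X, (pb1 z i ∘ k), l; split=> //.
    by rewrite comp_assoc -(pb_pair1 E) -!comp_assoc E'. }
  move=> T P A B z _ IHA _ IHB T' f; apply: (loc_sum (z := z ∘ f)).
  + exact: piece IHA _ _.
  + exact: piece IHB _ _.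
- by move=> T P z T' f; apply: loc_zero; exact: (z ∘ f).
Qed.

Lemma from_zero_eq (T Y : C) (u v : hom T Y) : hom T zero -> u = v.
Proof.
move=> z; have [k [kz _]] := zero_stable z.
rewrite -(comp_idr u) -(comp_idr v) -kz !comp_assoc; congr (_ ∘ _).
exact: cobang_uniq.
Qed.

(** Covers are jointly epic: representable presheaves are separated. *)
Lemma loc_eq (T : C) (P : forall U : C, hom U T -> Prop) : locally P ->
  forall Y (u v : hom T Y), (forall U f, P U f -> u ∘ f = v ∘ f) -> u = v.
Proof.
elim=> {T P}.
- by move=> T P HP Y u v /(_ _ _ HP); rewrite !comp_idr.
- move=> T P U e He _ IH Y u v H; apply: (regular_epi_epi He).
  by apply: IH => W g /H; rewrite !comp_assoc.
- move=> T P A B z _ IHA _ IHB Y u v H.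
  have [h [_ hU]] := @sum_stable _ _ _ _ z _ (u ∘ pb1 z (inl A B)) (u ∘ pb1 z (inr A B)).
  rewrite -(hU u) // -(hU v) //; split; symmetry.
  + by apply: IHA => W g /H; rewrite !comp_assoc.
  + by apply: IHB => W g /H; rewrite !comp_assoc.
- by move=> T P z Y u v _; apply: from_zero_eq.
Qed.

(** Representable presheaves are sheaves.  A relation that has at most one value,
    that restricts, and that can be checked locally has a global value as soon as
    it has local ones: the local values agree on overlaps. *)
Lemma glue (Y T : C) (P : forall U : C, hom U T -> Prop) : locally P ->
  forall Q : forall U : C, hom U T -> hom U Y -> Prop,
  (forall U f y W (g : hom W U), Q U f y -> Q W (f ∘ g) (y ∘ g)) ->
  (forall U f y y', Q U f y -> Q U f y' -> y = y') ->
  (forall U f y, locally (fun W (g : hom W U) => Q W (f ∘ g) (y ∘ g)) -> Q U f y) ->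
  (forall U f, P U f -> exists y, Q U f y) -> exists y, Q T (idm T) y.
Proof.
elim=> {T P}.
- by move=> T P HP Q _ _ _; apply.
- move=> T P U e He _ IH Q Qs Q1 Ql Qe.
  have [] := IH (fun W g y => Q W (e ∘ g) y).
  { by move=> W f y X g; rewrite comp_assoc; apply: Qs. }
  { by move=> W f y y'; apply: Q1. }
  { move=> W f y H; apply: Ql; apply: (loc_mono H) => X g; by rewrite comp_assoc. }
  { by move=> W f; apply: Qe. }
  move=> y; rewrite comp_idr => Qy.
  (* The overlap of the cover [e] with itself is seen through the two maps that
     [e] coequalizes. *)
  have [K [a [b [ab univ]]]] := He.
  have [|k [ky _]] := univ _ y.
  { by apply: (Q1 _ (e ∘ a)); [|rewrite ab]; apply: Qs. }
  exists k; apply: Ql; apply: (loc_cover He); apply: loc_here.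
  by rewrite comp_idl comp_idr ky.
- move=> T P A B z _ IHA _ IHB Q Qs Q1 Ql Qe.
  have piece : forall D (i : hom D T),
    ((forall U f y W (g : hom W U), Q U (i ∘ f) y -> Q W (i ∘ (f ∘ g)) (y ∘ g)) ->
     (forall U f y y', Q U (i ∘ f) y -> Q U (i ∘ f) y' -> y = y') ->
     (forall U f y, locally (fun W (g : hom W U) => Q W (i ∘ (f ∘ g)) (y ∘ g)) ->
        Q U (i ∘ f) y) ->
     (forall U f, P U (i ∘ f) -> exists y, Q U (i ∘ f) y) ->
     exists y, Q D (i ∘ idm D) y) -> exists y, Q D i y.
  { move=> D i [].
    - by move=> W f y X g; rewrite comp_assoc; apply: Qs.
    - by move=> W f y y'; apply: Q1.
    - move=> W f y H; apply: Ql; apply: (loc_mono H) => X g; by rewrite comp_assoc.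
    - by move=> W f; apply: Qe.
    - by move=> y; rewrite comp_idr => Qy; exists y. }
  have [yA QA] := piece _ _ (IHA (fun W g y => Q W (_ ∘ g) y)).
  have [yB QB] := piece _ _ (IHB (fun W g y => Q W (_ ∘ g) y)).
  have [y [[EA EB] _]] := @sum_stable _ _ _ _ z _ yA yB.
  exists y; apply: Ql; apply: (loc_sum (z := z)); apply: loc_here;
    by rewrite comp_idl comp_idr ?EA ?EB.
- move=> T P z Q _ _ Ql _; exists (cobang Y ∘ z); apply: Ql; exact: loc_zero.
Qed.

(** Membership in a subobject is the existence of a lift, unique because the
    inclusion is mono, so local lifts glue. *)
Lemma loc_in (X : C) (A : sub X) (T : C) (x : hom T X) :
  locally (fun U f => sub_in A (x ∘ f)) -> sub_in A x.
Proof.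
move=> H.
have [] := @glue A _ _ H (fun U f y => sub_map A ∘ y = x ∘ f).
- by move=> U f y W g E; rewrite !comp_assoc E.
- by move=> U f y y' E E'; apply: (@sub_mono _ _ A); rewrite E.
- move=> U f y L; apply: (loc_eq L) => W g; by rewrite !comp_assoc.
- by move=> U f.
- by move=> y; rewrite comp_idr; exists y.
Qed.

Lemma sub_in_image (X Y : C) (f : hom X Y) (T : C) (y : hom T Y) :
  sub_in (image f) y <-> locally (fun U k => exists x : hom U X, f ∘ x = y ∘ k).
Proof.
split.
- case=> h <-; apply: (loc_cover (regular_epi_stable h (image_cover_regular f))).
  apply: loc_here; exists (pb2 h (image_cover f)).
  rewrite comp_idr -!comp_assoc pb_comm comp_assoc; by rewrite image_fact.
- move=> H; apply: loc_in; apply: (loc_mono H) => U k [x <-].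
  by exists (image_cover f ∘ x); rewrite comp_assoc image_fact.
Qed.

Lemma sub_in_bot (X T : C) (x : hom T X) :
  sub_in (sub_bot X) x <-> locally (fun U (_ : hom U T) => False).
Proof.
split.
- move/sub_in_image => H; apply: (loc_bind H) => U k [z _]; exact: loc_zero.
- move=> H; apply: loc_in; exact: (loc_mono H).
Qed.

Lemma sub_in_or (X : C) (A B : sub X) (T : C) (x : hom T X) :
  sub_in (sub_or A B) x <->
  locally (fun U k => sub_in A (x ∘ k) \/ sub_in B (x ∘ k)).
Proof.
split.
- move/sub_in_image => H; apply: (loc_bind H) => U k [z E].
  apply: (loc_sum (z := z)); apply: loc_here; [left|right].
  + exists (pb2 z (inl A B)); rewrite comp_idr comp_assoc -E -comp_assoc pb_comm.
    by rewrite comp_assoc copair_inl.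
  + exists (pb2 z (inr A B)); rewrite comp_idr comp_assoc -E -comp_assoc pb_comm.
    by rewrite comp_assoc copair_inr.
- move=> H; apply/sub_in_image; apply: (loc_mono H) => U k [] [h <-].
  + by exists (inl A B ∘ h); rewrite comp_assoc copair_inl.
  + by exists (inr A B ∘ h); rewrite comp_assoc copair_inr.
Qed.

(** The adjunction only speaks of subobjects; to test membership of [y] it is
    applied to the image of [y]. *)
Lemma sub_in_all (X Y : C) (f : hom X Y) (A : sub X) (T : C) (y : hom T Y) :
  sub_in (sub_all f A) y <->
  forall (U : C) (k : hom U T) (x : hom U X), f ∘ x = y ∘ k -> sub_in A x.
Proof.
split.
- move=> H U k x E.
  have /sub_leP : sub_le (sub_pull f (@sub_all C _ _ f A)) A.
  { by apply/sub_all_adj; exists (idm _); rewrite comp_idr. }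
  by apply; apply/sub_in_pull; rewrite E; apply: sub_in_comp.
- move=> H.
  have /sub_leP : sub_le (image y) (@sub_all C _ _ f A).
  { apply/sub_all_adj; apply/sub_leP => U x /sub_in_pull /sub_in_image L.
    apply: loc_in; apply: (loc_mono L) => W k [t E].
    by apply: (H _ t); rewrite comp_assoc. }
  apply; apply/sub_in_image; apply: loc_here; exists (idm T); by [].
Qed.

Lemma sub_in_imp (X : C) (A B : sub X) (T : C) (x : hom T X) :
  sub_in (sub_imp A B) x <->
  forall (U : C) (k : hom U T), sub_in A (x ∘ k) -> sub_in B (x ∘ k).
Proof.
rewrite sub_in_all; split.
- move=> H U k [h E]; rewrite -E; apply/sub_in_pull; exact: (H _ k).
- move=> H U k h E; apply/sub_in_pull; rewrite E; apply: H; by exists h.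
Qed.

Lemma sub_in_and (X : C) (A B : sub X) (T : C) (x : hom T X) :
  sub_in (sub_and A B) x <-> sub_in A x /\ sub_in B x.
Proof.
split.
- case=> h /= <-; split.
  + by exists (pb1 (sub_map A) (sub_map B) ∘ h); rewrite comp_assoc.
  + by exists (pb2 (sub_map A) (sub_map B) ∘ h); rewrite comp_assoc pb_comm.
- case=> [[h Ah] [k Bk]].
  have E : sub_map A ∘ h = sub_map B ∘ k by rewrite Ah Bk.
  by exists (pb_pair E); rewrite /= -comp_assoc pb_pair1.
Qed.

Lemma sub_in_ex (X Y : C) (f : hom X Y) (A : sub X) (T : C) (y : hom T Y) :
  sub_in (sub_ex f A) y <->
  locally (fun U k => exists x : hom U X, f ∘ x = y ∘ k /\ sub_in A x).
Proof.
rewrite sub_in_image; split=> H; apply: (loc_mono H) => U k.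
- by case=> z <-; exists (sub_map A ∘ z); rewrite comp_assoc; split=> //; exists z.
- by case=> x [<- [z <-]]; exists z; rewrite comp_assoc.
Qed.

Lemma sub_in_diag (X T : C) (x y : hom T X) : sub_in (sub_diag X) (pair x y) <-> x = y.
Proof.
split.
- case=> h /=; rewrite /diag pair_comp comp_idl => /pair_inj [<- <-]; by [].
- by move->; exists y; rewrite /= /diag pair_comp comp_idl.
Qed.

Lemma locally_surjective_epi (X Y : C) (e : hom X Y) :
  locally (fun U (k : hom U Y) => exists x : hom U X, e ∘ x = k) -> epi e.
Proof.
move=> H T u v uv; apply: (loc_eq H) => U k [x <-]; by rewrite !comp_assoc uv.
Qed.

End Local.

(** * Powerclasses and comprehension *)

Section Membership.
Variables (C : heyting_pretopos) (S : arrows C).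

Definition pmem (X : C) (P : powerclass S X) (T : C) (x : hom T X) (p : hom T P) : Prop :=
  sub_in (pow_mem P) (pair p x).

Lemma pmem_comp (X : C) (P : powerclass S X) (T U : C) (x : hom T X) (p : hom T P)
  (f : hom U T) : pmem x p -> pmem (x ∘ f) (p ∘ f).
Proof. by rewrite /pmem -pair_comp; apply: sub_in_comp. Qed.

Lemma loc_pmem (X : C) (P : powerclass S X) (T : C) (x : hom T X) (p : hom T P) :
  locally (fun U f => pmem (x ∘ f) (p ∘ f)) -> pmem x p.
Proof. by move=> H; apply: loc_in; apply: (loc_mono H) => U f; rewrite pair_comp. Qed.

Lemma pow_rel_in (X : C) (P : powerclass S X) (T U : C) (p : hom T P) (t : hom U T)
  (x : hom U X) : sub_in (pow_rel p) (pair t x) <-> pmem x (p ∘ t).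
Proof.
have [H H'] := pow_nat (idm (pow_ob P)) p.
rewrite comp_idl in H H'; move: H H' => /sub_leP H /sub_leP H'; rewrite /pmem.
split.
- move/H /sub_in_pull; by cat.
- move=> M; apply: H'; apply/sub_in_pull; by cat.
Qed.

Lemma pmem_ext (X : C) (P : powerclass S X) (T : C) (p q : hom T P) :
  (forall (U : C) (t : hom U T) (x : hom U X), pmem x (p ∘ t) <-> pmem x (q ∘ t)) ->
  p = q.
Proof.
move=> H; apply: pow_inj; split; apply/sub_leP => U z;
  by rewrite -(pair_eta z) !pow_rel_in H.
Qed.

Definition elt (X : C) (P : powerclass S X) (T : C) (p : hom T P) : C := pow_rel p.
(** The object of elements of [p] is the span [elt_base], [elt_val].  Both legs
    are locked so that rewriting by associativity leaves them whole. *)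
Definition elt_base (X : C) (P : powerclass S X) (T : C) (p : hom T P) :
  hom (elt p) T := locked (pr1 ∘ sub_map (pow_rel p)).
Definition elt_val (X : C) (P : powerclass S X) (T : C) (p : hom T P) :
  hom (elt p) X := locked (pr2 ∘ sub_map (pow_rel p)).

Lemma elt_small (X : C) (P : powerclass S X) (T : C) (p : hom T P) : S (elt_base p).
Proof. rewrite /elt_base -lock; exact: pow_small. Qed.

Lemma eltP (X : C) (P : powerclass S X) (T : C) (p : hom T P) (U : C) (t : hom U T)
    (x : hom U X) :
  pmem x (p ∘ t) <-> exists z : hom U (elt p), elt_base p ∘ z = t /\ elt_val p ∘ z = x.
Proof.
rewrite -pow_rel_in; split.
- case=> z E; exists z; rewrite /elt_base /elt_val -!lock -!comp_assoc E; by cat.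
- case=> z [<- <-]; exists z; rewrite -(pair_eta (sub_map _ ∘ z)).
  by rewrite /elt_base /elt_val -!lock -!comp_assoc.
Qed.

Lemma elt_mem (X : C) (P : powerclass S X) (T : C) (p : hom T P) (U : C)
  (z : hom U (elt p)) : pmem (elt_val p ∘ z) (p ∘ (elt_base p ∘ z)).
Proof. by apply/eltP; exists z. Qed.

Lemma elt_eq (X : C) (P : powerclass S X) (T : C) (p : hom T P) (U : C)
    (z z' : hom U (elt p)) :
  elt_base p ∘ z = elt_base p ∘ z' -> elt_val p ∘ z = elt_val p ∘ z' -> z = z'.
Proof.
rewrite /elt_base /elt_val -!lock -!comp_assoc => E E'.
by apply: (@sub_mono _ _ (pow_rel p)); apply: prod_uniq.
Qed.

Variable N : nno C.
Hypothesis HS : small_maps S N.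

Lemma image_small_rel (T X Z : C) (g : hom Z T) (h : hom Z X) :
  S g -> small_rel S (image (pair g h)).
Proof.
move=> Sg; rewrite /small_rel.
apply: (small_quotient HS (e := image_cover (pair g h))).
- exact: regular_epi_epi (image_cover_regular _).
- by rewrite -comp_assoc image_fact pr1_pair.
Qed.

(** A small family is named by its image: the cover of the image is epi, and
    quotients of small maps are small. *)
Lemma small_family (X : C) (P : powerclass S X) (T Z : C) (g : hom Z T) (h : hom Z X) :
  S g -> exists p : hom T P, forall (U : C) (t : hom U T) (x : hom U X),
    pmem x (p ∘ t) <->
    locally (fun W k => exists z : hom W Z, g ∘ z = t ∘ k /\ h ∘ z = x ∘ k).
Proof.
move=> Sg; have [p [/sub_leP H /sub_leP H']] := pow_surj P (image_small_rel h Sg).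
exists p => U t x; rewrite -pow_rel_in.
have E : locally (fun W k => exists z : hom W Z, pair g h ∘ z = pair t x ∘ k) <->
  locally (fun W k => exists z : hom W Z, g ∘ z = t ∘ k /\ h ∘ z = x ∘ k).
{ split=> L; apply: (loc_mono L) => W k [z].
  - rewrite !pair_comp => /pair_inj [<- <-]; by exists z.
  - by case=> e1 e2; exists z; rewrite !pair_comp e1 e2. }
rewrite -E -sub_in_image; split; [exact: H | exact: H'].
Qed.

Hypothesis HM : axiom_M S.

(** Since monos are small, [P_s 1] classifies all subobjects, as in a topos.
    The classifying maps of the image of [e] and of the whole of [Y] agree after
    composition with [e], so they agree.  Hence every epi is regular. *)
Lemma image_of_epi (X Y : C) (e : hom X Y) : epi e -> sub_in (image e) (idm Y).
Proof.
move=> He; have [P] := small_powerclass HS one.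
have classify : forall A : sub Y, exists p : hom Y P, forall (U : C) (y : hom U Y)
    (x : hom U one), pmem x (p ∘ y) <-> sub_in A y.
{ move=> A.
  have [p Hp] := small_family P (bang A) (HM (@sub_mono _ _ A)).
  exists p => U y x; rewrite Hp; split.
  - move=> L; apply: loc_in; apply: (loc_mono L) => W k [z [<- _]]; by exists z.
  - case=> z <-; apply: loc_here; exists z; split; first by cat.
    exact: bang_uniq. }
have [p Hp] := classify (image e); have [q Hq] := classify (sub_top Y).
have pq : p = q.
{ apply: He; apply: pmem_ext => U t x; rewrite -!comp_assoc Hp Hq; split=> _.
  - by exists (e ∘ t); rewrite comp_idl.
  - by apply: sub_in_comp; exists (image_cover e); rewrite image_fact. }
apply/(Hp _ _ (bang Y)); rewrite pq; apply/Hq; exact: sub_in_map.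
Qed.

Lemma epi_locally_surjective (X Y : C) (e : hom X Y) (T : C) (y : hom T Y) :
  epi e -> locally (fun U k => exists x : hom U X, e ∘ x = y ∘ k).
Proof.
move=> He; apply/sub_in_image; rewrite -(comp_idl y); apply: sub_in_comp.
exact: image_of_epi.
Qed.

End Membership.

(** * Morphisms of coalgebras as colourings *)

Section SliceEpi.
Variables (C : lexcat) (B : C).

Lemma slice_epi (X Y : slice B) (e : hom X Y) : epi (s_mor e) -> epi e.
Proof.
move=> He T u v E; apply: slice_hom_eq; apply: He.
exact: (f_equal (@s_mor _ _ _ _) E).
Qed.

(** Maps [Y -> T] of [C] become maps over [B] once paired with the structure map
    of [Y], as maps into the pullback of [T] to the slice. *)
Lemma epi_slice (X Y : slice B) (e : hom X Y) : epi e -> epi (s_mor e).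
Proof.
move=> He T u v E.
have Eu : @s_map C B (reindex B T) ∘ pair (s_map Y) u = s_map Y by apply: pr1_pair.
have Ev : @s_map C B (reindex B T) ∘ pair (s_map Y) v = s_map Y by apply: pr1_pair.
have /(f_equal (@s_mor _ _ _ _)) /= :
    @SliceHom C B Y (reindex B T) _ Eu = @SliceHom C B Y (reindex B T) _ Ev.
{ apply: He; apply: slice_hom_eq => /=; by rewrite !pair_comp E. }
by move/pair_inj => [].
Qed.

Lemma slice_mono_mor (X Y : slice B) (m : hom X Y) : mono m -> mono (s_mor m).
Proof.
move=> Hm Z u v E.
pose Z' := @SliceOb C B Z (s_map X ∘ u).
have Ev : s_map X ∘ v = s_map Z'.
{ by rewrite /= !(slice_map_comp m) E. }
have /(f_equal (@s_mor _ _ _ _)) // :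
  @SliceHom C B Z' X u eq_refl = @SliceHom C B Z' X v Ev.
by apply: Hm; apply: slice_hom_eq.
Qed.

Lemma reindex_prodmap (X Y : C) (T : slice B) (g : hom (reindex B X) (reindex B Y)) :
  reindex_prod_inv Y T ∘ (s_mor (prodmap (idm T) g) ∘ reindex_prod X T) =
  pair pr1 (pr2 ∘ (s_mor g ∘ pair (s_map T ∘ pr1) pr2)).
Proof.
rewrite /reindex_prod_inv pair_comp -!comp_assoc; congr (pair _ _).
- rewrite comp_assoc.
  have -> : s_mor (@pr1 (slice B) T (reindex B Y)) ∘ s_mor (prodmap (idm T) g)
    = s_mor (@pr1 (slice B) T (reindex B X)).
  { change (s_mor (@pr1 (slice B) T (reindex B Y) ∘ prodmap (idm T) g)
      = s_mor (@pr1 (slice B) T (reindex B X))); congr s_mor.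
    by rewrite /prodmap pr1_pair comp_idl. }
  exact: reindex_prod1.
- congr (_ ∘ _); rewrite comp_assoc.
  have -> : s_mor (@pr2 (slice B) T (reindex B Y)) ∘ s_mor (prodmap (idm T) g)
    = s_mor g ∘ s_mor (@pr2 (slice B) T (reindex B X)).
  { change (s_mor (@pr2 (slice B) T (reindex B Y) ∘ prodmap (idm T) g)
      = s_mor (g ∘ @pr2 (slice B) T (reindex B X))); congr s_mor.
    by rewrite /prodmap pr2_pair. }
  by rewrite -comp_assoc reindex_prod2.
Qed.

End SliceEpi.

Section Coalgebras.
Variables (C : heyting_pretopos) (S : arrows C) (N : nno C).
Hypotheses (HS : small_maps S N) (HM : axiom_M S).

(** Being a morphism of coalgebras, read on generalized elements. *)
Definition colouring (A V : coalgebra S) (c : hom A V) : Prop :=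
  forall (T : C) (a : hom T A) (y : hom T V),
    pmem y (coalg_map V ∘ (c ∘ a)) <->
    locally (fun W k => exists x : hom W A,
      pmem x (coalg_map A ∘ (a ∘ k)) /\ c ∘ x = y ∘ k).

(** The direct image of a powerclass is given by an epi, and epis are the locally
    surjective maps; this turns [pow_map] into a local existence statement.
    The slice over the terminal object is a copy of [C]. *)
Lemma coalg_mor_colouring (A V : coalgebra S) (c : hom A V) :
  coalg_mor (A := reindex_coalgebra one A) (B := reindex_coalgebra one V)
    (reindex_map one c) <-> colouring c.
Proof.
set PA := coalg_pow A; set PV := coalg_pow V.
split.
- case=> h [[e [He E]] hE] T a y.
  (* Transport of [h] and its two equations from the slice to [C]. *)
  pose hu := pr2 ∘ s_mor h : hom (prod one PA) PV.
  have {}He := epi_slice He.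
  have {}hE : hu ∘ pair (bang T) (coalg_map A ∘ a) = coalg_map V ∘ (c ∘ a).
  { have /(f_equal (@s_mor _ _ _ _)) /= := hE.
    move/(f_equal (fun u : hom (prod one A) (prod one PV) => pr2 ∘ (u ∘ pair (bang T) a))).
    rewrite /prodmap; cat => H; rewrite -H /hu; by cat. }
  have {}E : sub_map (pow_rel hu) ∘ s_mor e =
    pair pr1 (c ∘ pr2) ∘ sub_map (pow_rel (pr2 ∘ idm (prod one PA))).
  { pose T' : slice one := reindex one PA.
    have {}E : (reindex_prod V T' ∘ sub_map (pow_rel hu)) ∘ s_mor e =
        s_mor (prodmap (idm T') (reindex_map one c)) ∘
          (reindex_prod A T' ∘ sub_map (pow_rel (pr2 ∘ idm (prod one PA)))).
    { exact: (f_equal (@s_mor _ _ _ _) E). }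
    have := f_equal (fun u => reindex_prod_inv V T' ∘ u) E; lazy beta.
    rewrite -comp_assoc comp_assoc reindex_prodK comp_idl => ->.
    rewrite (comp_assoc (s_mor _)) comp_assoc reindex_prodmap /= /prodmap.
    by cat. }
  rewrite -hE -pow_rel_in; split.
  + case=> z Hz.
    apply: (loc_mono (epi_locally_surjective HS HM z He)) => W k [r Hr].
    have : pair pr1 (c ∘ pr2) ∘ (sub_map (pow_rel (pr2 ∘ idm (prod one PA))) ∘ r)
      = pair (pair (bang T) (coalg_map A ∘ a)) y ∘ k.
    { by rewrite comp_assoc -E -comp_assoc Hr comp_assoc Hz. }
    set r' := _ ∘ r; cat; case/pair_inj => E1 E2.
    exists (pr2 ∘ r'); split=> //.
    have : sub_in (pow_rel (pr2 ∘ idm (prod one PA))) r' by exists r.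
    rewrite -{1}(pair_eta r') pow_rel_in; cat; rewrite E1; by cat.
  + move=> L; apply: loc_in; apply: (loc_mono L) => W k [x [Hx Ex]].
    have [r Hr] : sub_in (pow_rel (pr2 ∘ idm (prod one PA)))
      (pair (pair (bang W) (coalg_map A ∘ (a ∘ k))) x).
    { apply/pow_rel_in; by cat. }
    exists (s_mor e ∘ r); rewrite comp_assoc E -comp_assoc Hr; cat.
    rewrite Ex; congr (pair (pair _ _) _); exact: bang_uniq.
- move=> Hc.
  (* The direct image map [P_s A -> P_s V], by comprehension at the generic
     subset of [A]. *)
  have [h Hh] := small_family HS PV (c ∘ elt_val (idm (pow_ob PA)))
    (elt_small (idm (pow_ob PA))).
  have {}Hh : forall (U : C) (p : hom U PA) (y : hom U V), pmem y (h ∘ p) <->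
    locally (fun W k => exists x, pmem x (p ∘ k) /\ c ∘ x = y ∘ k).
  { move=> U p y; rewrite Hh; split=> L; apply: (loc_mono L) => W k.
    - case=> z [Ez <-]; exists (elt_val (idm (pow_ob PA)) ∘ z); split; last by cat.
      rewrite -Ez; have := elt_mem z; by rewrite comp_idl.
    - case=> x []; rewrite -{1}(comp_idl p) -comp_assoc => /eltP [z [Ez Vz]] Ex.
      exists z; by rewrite -comp_assoc Vz. }
  exists (reindex_map one h); split; last first.
  { apply: slice_hom_eq; rewrite /= /prodmap; cat; congr (pair _ _).
    apply: pmem_ext => U t x; cat; rewrite Hh Hc.
    by split=> L; apply: (loc_mono L) => W k; cat. }
  pose hu := pr2 ∘ s_mor (reindex_map one h) : hom (prod one PA) PV.
  have huE : forall (T : C) (z : hom T (prod one PA)), hu ∘ z = h ∘ (pr2 ∘ z).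
  { by move=> T z; rewrite /hu /= /prodmap; cat. }
  pose R1 := pow_rel (pr2 ∘ idm (prod one PA)).
  have [e He] : sub_in (pow_rel hu) (pair pr1 (c ∘ pr2) ∘ sub_map R1).
  { rewrite pair_comp; apply/pow_rel_in; rewrite huE.
    apply/Hh; apply: loc_here; exists (pr2 ∘ sub_map R1); split; last by cat.
    have := sub_in_map R1; rewrite -{1}(pair_eta (sub_map R1)) pow_rel_in.
    by cat. }
  pose D1 := sub_ob (pow_mem (reindex_powerclass one PA)) : slice one.
  pose D2 := sub_ob (pow_rel (p := reindex_powerclass one PV) (reindex_map one h)) :
    slice one.
  have Es : s_map D2 ∘ e = s_map D1 by exact: bang_uniq.
  exists (@SliceHom C one D1 D2 e Es); split.
  + apply: slice_epi; apply: locally_surjective_epi.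
    have : sub_in (pow_rel hu) (sub_map (pow_rel hu)) by exact: sub_in_map.
    rewrite -[X in sub_in _ X](pair_eta (sub_map (pow_rel hu))) pow_rel_in.
    rewrite huE Hh => L.
    apply: (loc_mono L) => W k [x []]; cat => Hx Ex.
    have [r Hr] : sub_in R1 (pair (pr1 ∘ (sub_map (pow_rel hu) ∘ k)) x).
    { apply/pow_rel_in; by cat. }
    exists r; apply: (@sub_mono _ _ (pow_rel hu)).
    rewrite comp_assoc He -comp_assoc Hr -[RHS]pair_eta; cat; by rewrite Ex.
  + pose T' : slice one := reindex one PA.
    apply: slice_hom_eq.
    change ((reindex_prod V T' ∘ sub_map (pow_rel hu)) ∘ e =
        s_mor (prodmap (idm T') (reindex_map one c)) ∘ (reindex_prod A T' ∘ sub_map R1)).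
    rewrite -comp_assoc He -[RHS]reindex_prodVK_comp; congr (_ ∘ _).
    rewrite (comp_assoc (s_mor _)) comp_assoc reindex_prodmap /= /prodmap.
    by cat.
Qed.

Lemma terminal_colouring (A V : coalgebra S) : indexed_final_coalgebra V ->
  exists! c : hom A V, colouring c.
Proof.
move=> HV; have [f [Hf fU]] := HV one (reindex_coalgebra one A).
have fE : f = reindex_map one (pr2 ∘ (s_mor f ∘ pair (bang A) (idm A))).
{ apply: slice_hom_eq; apply: prod_uniq; first exact: bang_uniq.
  rewrite /= /prodmap; cat; rewrite -{1}(comp_idr (s_mor f)); congr (_ ∘ (_ ∘ _)).
  apply: prod_uniq; first exact: bang_uniq. by cat. }
exists (pr2 ∘ (s_mor f ∘ pair (bang A) (idm A))); split.
- by apply/coalg_mor_colouring; rewrite -fE.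
- move=> c /coalg_mor_colouring /fU ->; rewrite /= /prodmap; by cat.
Qed.

End Coalgebras.

(** * The universe of sets *)

Section Universe.
Variables (C : heyting_pretopos) (S : arrows C) (N : nno C).
Hypotheses (HS : small_maps S N) (HM : axiom_M S).
Variable V : coalgebra S.

Definition mem (T : C) (x y : hom T V) : Prop := pmem x (coalg_map V ∘ y).

Lemma mem_comp (T U : C) (x y : hom T V) (f : hom U T) : mem x y -> mem (x ∘ f) (y ∘ f).
Proof. by move/(pmem_comp f); rewrite -comp_assoc. Qed.

Lemma loc_mem (T : C) (x y : hom T V) :
  locally (fun U f => mem (x ∘ f) (y ∘ f)) -> mem x y.
Proof.
move=> H; apply: loc_pmem; apply: (loc_mono H) => U f; by rewrite -comp_assoc.
Qed.

Definition elts (T : C) (y : hom T V) : C := elt (coalg_map V ∘ y).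
Definition base (T : C) (y : hom T V) : hom (elts y) T := elt_base (coalg_map V ∘ y).
Definition val (T : C) (y : hom T V) : hom (elts y) V := elt_val (coalg_map V ∘ y).

Lemma base_small (T : C) (y : hom T V) : S (base y).
Proof. exact: elt_small. Qed.

Lemma memP (T : C) (y : hom T V) (U : C) (t : hom U T) (x : hom U V) :
  mem x (y ∘ t) <-> exists z : hom U (elts y), base y ∘ z = t /\ val y ∘ z = x.
Proof. by rewrite /mem comp_assoc eltP. Qed.

Lemma mem_elts (T : C) (y : hom T V) (U : C) (z : hom U (elts y)) :
  mem (val y ∘ z) (y ∘ (base y ∘ z)).
Proof. by apply/memP; exists z. Qed.

Lemma mem_val (T : C) (y : hom T V) : mem (val y) (y ∘ base y).
Proof. have := mem_elts (idm (elts y)); by rewrite !comp_idr. Qed.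

Lemma elts_eq (T : C) (y : hom T V) (U : C) (z z' : hom U (elts y)) :
  base y ∘ z = base y ∘ z' -> val y ∘ z = val y ∘ z' -> z = z'.
Proof. exact: elt_eq. Qed.

Hypothesis HV : indexed_final_coalgebra V.

(** A span [g, h : Z -> X], read as the set of edges of a graph on [X], is a
    coalgebra on [X] when its first leg is small: a node is sent to the family of
    its successors. *)
Lemma graph_colouring (X Z : C) (g h : hom Z X) : S g ->
  exists! c : hom X V, forall (T : C) (a : hom T X) (y : hom T V),
    mem y (c ∘ a) <->
    locally (fun W k => exists z : hom W Z, g ∘ z = a ∘ k /\ c ∘ (h ∘ z) = y ∘ k).
Proof.
move=> Sg; have [P] := small_powerclass HS X.
have [p Hp] := small_family HS P h Sg.
have E : forall c : hom X V, colouring (A := Coalgebra p) c <->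
  forall (T : C) (a : hom T X) (y : hom T V), mem y (c ∘ a) <->
    locally (fun W k => exists z : hom W Z, g ∘ z = a ∘ k /\ c ∘ (h ∘ z) = y ∘ k).
{ move=> c.
  have L : forall (T : C) (a : hom T X) (y : hom T V),
    locally (fun W k => exists x : hom W X, pmem x (p ∘ (a ∘ k)) /\ c ∘ x = y ∘ k) <->
    locally (fun W k => exists z : hom W Z, g ∘ z = a ∘ k /\ c ∘ (h ∘ z) = y ∘ k).
  { move=> T a y; split=> L.
    - apply: (loc_bind L) => W k [x [/Hp Hx Ex]]; apply: (loc_mono Hx) => W' k'.
      case=> z [Eg Eh]; exists z; by rewrite Eg Eh !comp_assoc Ex.
    - apply: (loc_mono L) => W k [z [Ez Hz]]; exists (h ∘ z); split=> //.
      apply/Hp; apply: loc_here; exists z; by rewrite !comp_idr. }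
  split=> H T a y; [rewrite -L | rewrite L]; exact: (H T a y). }
have [c [Hc cU]] := terminal_colouring HS HM (Coalgebra p) HV.
exists c; split; first exact/E.
by move=> c' /E; apply: cU.
Qed.

(** The direct image of the structure map [E] makes [P_s V] a coalgebra, and its
    colouring [c] is the inverse: [c] after [E] colours [V] itself, as the
    identity does. *)
Lemma lambek : exists c : hom (coalg_pow V) V,
  c ∘ coalg_map V = idm _ /\ coalg_map V ∘ c = idm _.
Proof.
pose PV := coalg_pow V; pose E := coalg_map V.
have [c [Hc _]] := graph_colouring (E ∘ elt_val (idm PV)) (elt_small (idm PV)).
have {}Hc : forall (T : C) (p : hom T PV) (y : hom T V), mem y (c ∘ p) <->
  locally (fun W k => exists x : hom W V, pmem x (p ∘ k) /\ c ∘ (E ∘ x) = y ∘ k).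
{ move=> T p y; rewrite Hc; split=> L; apply: (loc_mono L) => W k.
  - case=> z [Ez <-]; exists (elt_val (idm PV) ∘ z); rewrite !comp_assoc; split=> //.
    rewrite -Ez; have := elt_mem z; by rewrite comp_idl.
  - case=> x []; rewrite -{1}(comp_idl p) -comp_assoc => /eltP [z [Ez Vz]] Ex.
    exists z; by rewrite -comp_assoc Vz. }
have [u [_ uU]] := graph_colouring (elt_val E) (elt_small E).
have cE : c ∘ E = idm V.
{ have <- : u = c ∘ E; last have <- // : u = idm V; apply: uU.
  - move=> T a y; rewrite -comp_assoc Hc; split=> L; apply: (loc_mono L) => W k.
    + case=> x []; rewrite -comp_assoc => /eltP [z [Ez Vz]] Ex.
      exists z; split=> //; by rewrite Vz -comp_assoc.
    + case=> z [Ez Vz]; exists (elt_val E ∘ z).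
      split; last by rewrite comp_assoc.
      rewrite -(comp_assoc E) -Ez; exact: elt_mem.
  - move=> T a y; rewrite comp_idl; split.
    + rewrite /mem => /eltP [z [Ez Vz]].
      apply: loc_here; exists z; by rewrite comp_idl !comp_idr.
    + move=> L; apply: loc_mem; apply: (loc_mono L) => W k [z [<-]].
      rewrite comp_idl => <-; exact: elt_mem. }
exists c; split=> //; apply: pmem_ext => T p y.
rewrite comp_idl -comp_assoc; apply: iff_trans (Hc T p y) _; split.
- move=> L; apply: loc_pmem; apply: (loc_mono L) => W k [x [Hx]].
  by rewrite comp_assoc cE comp_idl => <-.
- move=> Hy; apply: loc_here; exists y; by rewrite comp_assoc cE comp_idl !comp_idr.
Qed.

Lemma mem_ext (T : C) (x y : hom T V) :
  (forall (U : C) (t : hom U T) (z : hom U V), mem z (x ∘ t) <-> mem z (y ∘ t)) ->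
  x = y.
Proof.
move=> H; have [c [cE _]] := lambek.
rewrite -(comp_idl x) -(comp_idl y) -cE -!comp_assoc; congr (_ ∘ _).
by apply: pmem_ext => U t z; have := H U t z; rewrite /mem !comp_assoc.
Qed.

(** Comprehension in [V], through the inverse of the structure map. *)
Lemma small_set (T Z : C) (g : hom Z T) (h : hom Z V) : S g ->
  exists y : hom T V, forall (U : C) (t : hom U T) (x : hom U V),
    mem x (y ∘ t) <->
    locally (fun W k => exists z : hom W Z, g ∘ z = t ∘ k /\ h ∘ z = x ∘ k).
Proof.
move=> Sg; have [p Hp] := small_family HS (coalg_pow V) h Sg.
have [c [_ Ec]] := lambek; exists (c ∘ p) => U t x.
by rewrite -Hp /mem !comp_assoc Ec comp_idl.
Qed.

End Universe.

Ltac env_eq :=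
  let i := fresh "i" in
  apply: functional_extensionality => i; revert i;
  repeat (let j := fresh "i" in
    intro j; apply (Fin.caseS' j); clear j; [| try (cbn; reflexivity)]);
  try (cbn; reflexivity).

(** * Forcing *)

Section Forcing.
Variables (C : heyting_pretopos) (S : arrows C) (V : coalgebra S).
Variable w : hom one (coalg_ob V).

Definition restrict n (T U : C) (rho : Fin.t n -> hom T V) (f : hom U T) :
  Fin.t n -> hom U V := fun i => rho i ∘ f.

Definition eval n (T : C) (rho : Fin.t n -> hom T V) (t : term n) : hom T V :=
  match t with Var i => rho i | Omega => w ∘ bang T end.

(** Environments are functions on variables, so that renaming variables is
    precomposition and the value of a concrete variable computes. *)
Fixpoint forces n (phi : form n) : forall T : C, (Fin.t n -> hom T V) -> Prop :=
  match phi with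
  | Bot => fun T rho => locally (fun U (_ : hom U T) => False)
  | Eq t u => fun T rho => eval rho t = eval rho u
  | Mem t u => fun T rho => mem (eval rho t) (eval rho u)
  | And a b => fun T rho => forces a rho /\ forces b rho
  | Or a b => fun T rho => locally (fun U (f : hom U T) =>
      forces a (restrict rho f) \/ forces b (restrict rho f))
  | Imp a b => fun T rho => forall U (f : hom U T),
      forces a (restrict rho f) -> forces b (restrict rho f)
  | All a => fun T rho => forall U (f : hom U T) (x : hom U V),
      forces a (scons x (restrict rho f))
  | Ex a => fun T rho => locally (fun U (f : hom U T) =>
      exists x : hom U V, forces a (scons x (restrict rho f)))
  end.

Lemma restrict_idm n (T : C) (rho : Fin.t n -> hom T V) : restrict rho (idm T) = rho.
Proof. apply: functional_extensionality => i; exact: comp_idr. Qed.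

Lemma restrict_comp n (T U W : C) (rho : Fin.t n -> hom T V) (f : hom U T)
  (g : hom W U) : restrict (restrict rho f) g = restrict rho (f ∘ g).
Proof.
by apply: functional_extensionality => i; rewrite /restrict comp_assoc.
Qed.

Lemma restrict_scons n (T U : C) (x : hom T V) (rho : Fin.t n -> hom T V)
  (f : hom U T) : restrict (scons x rho) f = scons (x ∘ f) (restrict rho f).
Proof. env_eq. Qed.

Lemma eval_restrict n (T U : C) (rho : Fin.t n -> hom T V) (f : hom U T) (t : term n) :
  eval (restrict rho f) t = eval rho t ∘ f.
Proof.
case: t => [i|] //=; rewrite -comp_assoc; congr (_ ∘ _); exact: bang_uniq.
Qed.

Lemma eval_lift n (T : C) (x : hom T V) (rho : Fin.t n -> hom T V) (t : term n) :
  eval (scons x rho) (lift t) = eval rho t.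
Proof. by case: t. Qed.

Lemma forces_ren m (phi : form m) n (r : Fin.t m -> Fin.t n) (T : C)
    (rho : Fin.t n -> hom T V) :
  forces (ren phi r) rho <-> forces phi (fun i => rho (r i)).
Proof.
have ev : forall m n (r : Fin.t m -> Fin.t n) (T : C) (rho : Fin.t n -> hom T V) t,
  eval rho (ren_term r t) = eval (fun i => rho (r i)) t.
{ by move=> ? ? ? ? ? []. }
have up : forall m n (r : Fin.t m -> Fin.t n) (T U : C) (rho : Fin.t n -> hom T V)
    (f : hom U T) x, (fun i => scons x (restrict rho f) (upren r i)) =
  scons x (restrict (fun i => rho (r i)) f).
{ intros; env_eq. }
elim: phi n r T rho => {m} /=.
- by [].
- by move=> m t u n r T rho; rewrite !ev.
- by move=> m t u n r T rho; rewrite !ev.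
- by move=> m a IHa b IHb n r T rho; rewrite IHa IHb.
- move=> m a IHa b IHb n r T rho.
  have Ha : forall U (f : hom U T), forces (ren a r) (restrict rho f) <->
    forces a (restrict (fun i => rho (r i)) f) by move=> U f; exact: IHa.
  have Hb : forall U (f : hom U T), forces (ren b r) (restrict rho f) <->
    forces b (restrict (fun i => rho (r i)) f) by move=> U f; exact: IHb.
  split=> L; apply: (loc_mono L) => U f; by rewrite Ha Hb.
- move=> m a IHa b IHb n r T rho.
  have Ha : forall U (f : hom U T), forces (ren a r) (restrict rho f) <->
    forces a (restrict (fun i => rho (r i)) f) by move=> U f; exact: IHa.
  have Hb : forall U (f : hom U T), forces (ren b r) (restrict rho f) <->
    forces b (restrict (fun i => rho (r i)) f) by move=> U f; exact: IHb.
  split=> H U f; [rewrite -Ha -Hb | rewrite Ha Hb]; exact: H.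
- move=> m a IHa n r T rho; split=> H U f x; have := H U f x;
    by rewrite IHa up.
- move=> m a IHa n r T rho; split=> L; apply: (loc_mono L) => U f [x Hx];
    exists x; move: Hx; by rewrite IHa up.
Qed.

Fixpoint tuple n (T : C) : (Fin.t n -> hom T V) -> hom T (ctx V n) :=
  match n with
  | 0 => fun _ => bang T
  | Datatypes.S m => fun rho => pair (tuple (fun i => rho (FS i))) (rho F1)
  end.

Lemma proj_tuple n (T : C) (rho : Fin.t n -> hom T V) (i : Fin.t n) :
  proj V i ∘ tuple rho = rho i.
Proof.
elim: i rho => {n} [n|n i IH] rho /=; cat => //; by rewrite IH.
Qed.

Lemma tuple_comp n (T U : C) (rho : Fin.t n -> hom T V) (f : hom U T) :
  tuple rho ∘ f = tuple (restrict rho f).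
Proof.
elim: n rho => [|n IH] rho /=; first exact: bang_uniq.
by rewrite pair_comp IH.
Qed.

Lemma scons_eta n (T : C) (rho : Fin.t (Datatypes.S n) -> hom T V) :
  rho = scons (rho F1) (fun i => rho (FS i)).
Proof. env_eq. Qed.

Lemma tuple_surj n (T : C) (x : hom T (ctx V n)) : exists rho, x = tuple rho.
Proof.
elim: n x => [|n IH] x; first by exists (Fin.case0 _); exact: bang_uniq.
have [rho E] := IH (pr1 ∘ x); exists (scons (pr2 ∘ x) rho) => /=.
rewrite -[LHS]pair_eta E; congr (pair (tuple _) _).
Qed.

Lemma eval_tuple n (T : C) (rho : Fin.t n -> hom T V) (t : term n) :
  interp_term w t ∘ tuple rho = eval rho t.
Proof.
case: t => [i|] /=; first exact: proj_tuple.
rewrite -comp_assoc; congr (_ ∘ _); exact: bang_uniq.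
Qed.

Lemma forces_interp n (phi : form n) (T : C) (rho : Fin.t n -> hom T V) :
  forces phi rho <-> sub_in (interp w phi) (tuple rho).
Proof.
elim: phi T rho => {n} /=.
- by move=> n T rho; rewrite sub_in_bot.
- by move=> n t u T rho; rewrite sub_in_pull pair_comp !eval_tuple sub_in_diag.
- by move=> n t u T rho; rewrite sub_in_pull pair_comp -comp_assoc !eval_tuple.
- by move=> n a IHa b IHb T rho; rewrite sub_in_and IHa IHb.
- move=> n a IHa b IHb T rho; rewrite sub_in_or; split=> L; apply: (loc_mono L) => U f.
  + by case=> [/IHa|/IHb]; rewrite -tuple_comp; [left|right].
  + by rewrite tuple_comp => -[/IHa|/IHb]; [left|right].
- move=> n a IHa b IHb T rho; rewrite sub_in_imp; split=> H U f.
  + by rewrite tuple_comp => /IHa /H /IHb.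
  + by move/IHa; rewrite -tuple_comp => /H; rewrite tuple_comp => /IHb.
- move=> n a IHa T rho; rewrite sub_in_all; split=> H U f x.
  + move=> E; have [rho' Ex] := @tuple_surj (Datatypes.S n) _ x; rewrite Ex; apply/IHa.
    have -> : rho' = scons (rho' F1) (restrict rho f); last exact: H.
    rewrite {1}(scons_eta rho'); congr (scons _ _).
    apply: functional_extensionality => i.
    move: E; rewrite Ex /=; cat; rewrite tuple_comp => E.
    by rewrite -(proj_tuple (fun i => rho' (FS i))) E proj_tuple.
  + apply/IHa; apply: (H U f); rewrite /=; cat; by rewrite tuple_comp.
- move=> n a IHa T rho; rewrite sub_in_ex; split=> L; apply: (loc_mono L) => U f [x].
  + move/IHa => Hx; exists (tuple (scons x (restrict rho f))); split=> //=; cat.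
    by rewrite tuple_comp.
  + case=> E; have [rho' Ex] := @tuple_surj (Datatypes.S n) _ x; rewrite Ex => /IHa H.
    exists (rho' F1); move: H; congr (forces a _).
    rewrite {1}(scons_eta rho'); congr (scons _ _).
    apply: functional_extensionality => i.
    move: E; rewrite Ex /=; cat; rewrite tuple_comp => E.
    by rewrite -(proj_tuple (fun i => rho' (FS i))) E proj_tuple.
Qed.

Lemma forces_restrict n (phi : form n) (T U : C) (rho : Fin.t n -> hom T V)
  (f : hom U T) : forces phi rho -> forces phi (restrict rho f).
Proof. by rewrite !forces_interp -tuple_comp; apply: sub_in_comp. Qed.

Lemma loc_forces n (phi : form n) (T : C) (rho : Fin.t n -> hom T V) :
  locally (fun U f => forces phi (restrict rho f)) -> forces phi rho.
Proof.
move=> L; apply/forces_interp; apply: loc_in; apply: (loc_mono L) => U f.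
by rewrite tuple_comp forces_interp.
Qed.

Lemma valid_closure n (phi : form n) :
  valid w (closure phi) <-> forall (T : C) (rho : Fin.t n -> hom T V), forces phi rho.
Proof.
elim: n phi => [|n IH] phi.
- rewrite /= /valid sub_leP; split.
  + move=> H T rho; apply/forces_interp; apply: H; exists (tuple rho).
    by rewrite comp_idl.
  + move=> H T x _; have [rho ->] := tuple_surj x; exact/forces_interp.
- rewrite /= IH /=; split=> H T rho.
  + rewrite (scons_eta rho) -[X in scons _ X]restrict_idm; exact: H.
  + by move=> U f x; apply: H.
Qed.

Lemma forces_And n (a b : form n) (T : C) (rho : Fin.t n -> hom T V) :
  forces (And a b) rho <-> forces a rho /\ forces b rho.
Proof. by []. Qed.

Lemma forces_Ex n (phi : form (Datatypes.S n)) (T : C) (rho : Fin.t n -> hom T V) :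
  forces (Ex phi) rho <->
  locally (fun U (f : hom U T) => exists x, forces phi (scons x (restrict rho f))).
Proof. by []. Qed.

Lemma forces_Or n (a b : form n) (T : C) (rho : Fin.t n -> hom T V) :
  forces (Or a b) rho <-> locally (fun U (f : hom U T) =>
    forces a (restrict rho f) \/ forces b (restrict rho f)).
Proof. by []. Qed.

Lemma forces_mem_lift n (t : term n) (T U : C) (rho : Fin.t n -> hom T V) (f : hom U T)
    (x : hom U V) :
  forces (Mem v0 (lift t)) (scons x (restrict rho f)) <-> mem x (eval rho t ∘ f).
Proof. by rewrite /= eval_lift eval_restrict. Qed.

Lemma forces_all_imp n (a b : form (Datatypes.S n)) (T : C) (rho : Fin.t n -> hom T V) :
  forces (All (Imp a b)) rho <->
  forall U (f : hom U T) (x : hom U V),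
    forces a (scons x (restrict rho f)) -> forces b (scons x (restrict rho f)).
Proof.
split=> /= H U f x.
- by have := H U f x U (idm U); rewrite restrict_idm.
- move=> W g; rewrite restrict_scons restrict_comp; exact: H.
Qed.

Lemma forces_all_iff n (a b : form (Datatypes.S n)) (T : C) (rho : Fin.t n -> hom T V) :
  forces (All (Iff a b)) rho <->
  forall U (f : hom U T) (x : hom U V),
    forces a (scons x (restrict rho f)) <-> forces b (scons x (restrict rho f)).
Proof.
split=> [H|H].
- move=> U f x; have [/= Hab Hba] := H U f x; split.
  + by have := Hab U (idm U); rewrite restrict_idm.
  + by have := Hba U (idm U); rewrite restrict_idm.
- move=> U f x; split=> W g; rewrite restrict_scons restrict_comp; apply H.
Qed.

Lemma forces_AllIn n (t : term n) (phi : form (Datatypes.S n)) (T : C)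
    (rho : Fin.t n -> hom T V) :
  forces (AllIn t phi) rho <->
  forall U (f : hom U T) (x : hom U V),
    mem x (eval rho t ∘ f) -> forces phi (scons x (restrict rho f)).
Proof.
rewrite /AllIn forces_all_imp /=; split=> H U f x; have := H U f x;
  by rewrite eval_lift eval_restrict.
Qed.

Lemma forces_ExIn n (t : term n) (phi : form (Datatypes.S n)) (T : C)
    (rho : Fin.t n -> hom T V) :
  forces (ExIn t phi) rho <->
  locally (fun U (f : hom U T) => exists x : hom U V,
    mem x (eval rho t ∘ f) /\ forces phi (scons x (restrict rho f))).
Proof.
rewrite /ExIn /=; split=> L; apply: (loc_mono L) => U f [x Hx]; exists x; move: Hx;
  by rewrite eval_lift eval_restrict.
Qed.

Lemma forces_here_ex n (phi : form (Datatypes.S n)) (T : C)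
    (rho : Fin.t n -> hom T V) (x : hom T V) :
  forces phi (scons x rho) -> forces (Ex phi) rho.
Proof. by move=> H; apply: loc_here; exists x; rewrite restrict_idm. Qed.

(** Unique choice: local witnesses of a unique existence agree on overlaps, so
    they glue to a witness at the stage itself. *)
Lemma forces_ExU n (phi : form (Datatypes.S n)) (T : C) (rho : Fin.t n -> hom T V) :
  forces (ExU phi) rho <->
  exists x : hom T V, forall U (f : hom U T) (y : hom U V),
    forces phi (scons y (restrict rho f)) <-> y = x ∘ f.
Proof.
have uniq : forall (T : C) (rho : Fin.t n -> hom T V) x,
  forces (And phi (All (Imp (ren phi (scons F1 (fun i => FS (FS i)))) (Eq v0 v1))))
    (scons x rho) <->
  forall U (f : hom U T) (y : hom U V),
    forces phi (scons y (restrict rho f)) <-> y = x ∘ f.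
{ move=> {}T {}rho x.
  have E : forall U (f : hom U T) y,
    (fun i => scons y (restrict (scons x rho) f) (scons F1 (fun i => FS (FS i)) i)) =
      scons y (restrict rho f).
  { move=> U f y; env_eq. }
  rewrite forces_And forces_all_imp; split.
  - case=> H U1 U f y; split.
    + have := U1 U f y; by rewrite forces_ren /= E.
    + by move->; have := forces_restrict f H; rewrite restrict_scons.
  - move=> H; split.
    + have := H T (idm T) x; rewrite restrict_idm comp_idr => -[_]; exact.
    + move=> U f y; rewrite forces_ren E /= => /H ->; by []. }
rewrite /ExU; split.
- move=> L.
  have [] := @glue C V T _ L (fun U f x => forall W (g : hom W U) (y : hom W V),
    forces phi (scons y (restrict rho (f ∘ g))) <-> y = x ∘ g).
  + move=> U f y W g H W' g' y'; by rewrite -!comp_assoc H.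
  + move=> U f y y' H H'; have := H U (idm U) y; have := H' U (idm U) y.
    rewrite !comp_idr => -> ->; split; by [].
  + move=> U f y L' W g y'; split=> H.
    * apply: (loc_eq (loc_sieve L' g)) => W' g' [X [k [l [HX E]]]].
      rewrite -comp_assoc E comp_assoc; apply/HX.
      rewrite -comp_assoc -E comp_assoc -restrict_comp -restrict_scons.
      exact: forces_restrict.
    * apply: loc_forces; apply: (loc_mono (loc_sieve L' g)) => W' g' [X [k [l [HX E]]]].
      rewrite H restrict_scons restrict_comp -!comp_assoc E (comp_assoc f) (comp_assoc y).
      exact/HX.
  + move=> U f [x /uniq Hx]; exists x => W g y; by rewrite -restrict_comp.
  + move=> x Hx; exists x => U f y; have := Hx U f y; by rewrite comp_idl.
- case=> x Hx; apply: forces_here_ex; apply/uniq; exact: Hx.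
Qed.

End Forcing.

(** * Operations on sets *)

Section SetOperations.
Variables (C : heyting_pretopos) (S : arrows C) (N : nno C).
Hypotheses (HS : small_maps S N) (HM : axiom_M S).
Variable V : coalgebra S.
Hypothesis HV : indexed_final_coalgebra V.

(** Two small families over [T] form one, indexed by the sum of their index
    objects. *)
Lemma small_set_union (T Z1 Z2 : C) (g1 : hom Z1 T) (h1 : hom Z1 V) (g2 : hom Z2 T)
    (h2 : hom Z2 V) : S g1 -> S g2 ->
  exists y : hom T V, forall (U : C) (t : hom U T) (x : hom U V),
    mem x (y ∘ t) <->
    locally (fun W k => (exists z : hom W Z1, g1 ∘ z = t ∘ k /\ h1 ∘ z = x ∘ k) \/
                        (exists z : hom W Z2, g2 ∘ z = t ∘ k /\ h2 ∘ z = x ∘ k)).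
Proof.
move=> S1 S2.
have [y Hy] := small_set HS HM HV (copair h1 h2) (small_copair HS S1 S2).
exists y => U t x; rewrite Hy; split=> L.
- apply: (loc_bind L) => W k [z [Ez Hz]]; apply: (loc_sum (z := z)); apply: loc_here;
    [left; exists (pb2 z (inl Z1 Z2)) | right; exists (pb2 z (inr Z1 Z2))];
    rewrite !comp_idr !comp_assoc -Ez -Hz -!comp_assoc pb_comm !comp_assoc;
    by rewrite ?copair_inl ?copair_inr.
- apply: (loc_mono L) => W k [] [z [<- <-]].
  + exists (inl Z1 Z2 ∘ z); by rewrite !comp_assoc !copair_inl.
  + exists (inr Z1 Z2 ∘ z); by rewrite !comp_assoc !copair_inr.
Qed.

Lemma empty_set : exists o : hom one V, forall (U : C) (t : hom U one) (x : hom U V),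
  mem x (o ∘ t) <-> locally (fun W (_ : hom W U) => False).
Proof.
have S0 : S (cobang (one : C)).
{ apply: HM => T u v _; exact: from_zero_eq u. }
have [o Ho] := small_set HS HM HV (cobang V) S0.
exists o => U t x; rewrite Ho; split=> L; last exact: (loc_mono L).
apply: (loc_bind L) => W k [z _]; exact: loc_zero.
Qed.

Lemma unordered_pair : exists up : hom (prod V V) V,
  forall (U : C) (x y z : hom U V), mem z (up ∘ pair x y) <->
    locally (fun W (k : hom W U) => z ∘ k = x ∘ k \/ z ∘ k = y ∘ k).
Proof.
have [up H] := small_set_union pr1 pr2 (small_id HS _) (small_id HS (prod V V)).
exists up => U x y z; rewrite H; split=> L; apply: (loc_mono L) => W k.
- case=> -[p [Ep Hp]]; rewrite comp_idl in Ep; rewrite Ep in Hp; move: Hp; cat;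
    by [left|right].
- by case=> ->; [left|right]; exists (pair x y ∘ k); cat.
Qed.

Lemma successor : exists s : hom V V, forall (U : C) (x z : hom U V),
  mem z (s ∘ x) <-> locally (fun W (k : hom W U) => mem (z ∘ k) (x ∘ k) \/ z ∘ k = x ∘ k).
Proof.
have [s H] := small_set_union (val (idm V)) (idm V) (base_small (idm V)) (small_id HS V).
exists s => U x z; rewrite H.
have E : forall (W : C) (k : hom W U), mem (z ∘ k) (x ∘ k) <-> exists z0,
  base (idm V) ∘ z0 = x ∘ k /\ val (idm V) ∘ z0 = z ∘ k.
{ by move=> W k; rewrite -memP comp_idl. }
split=> L; apply: (loc_mono L) => W k.
- by case=> [/E|[u [<-]]]; [left|rewrite !comp_idl; right].
- by case=> [/E|<-]; [left|right; exists (z ∘ k); rewrite comp_idl].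
Qed.

(** The elements of the elements of [a] are small over the elements of [a], hence
    over [T]. *)
Lemma union_set (T : C) (a : hom T V) : exists y : hom T V,
  forall (U : C) (t : hom U T) (x : hom U V), mem x (y ∘ t) <->
    locally (fun W k => exists b : hom W V, mem (x ∘ k) b /\ mem b (a ∘ (t ∘ k))).
Proof.
have [y H] := small_set HS HM HV (val (val a))
  (small_comp HS (base_small a) (base_small (val a))).
exists y => U t x; rewrite H; split=> L; apply: (loc_mono L) => W k.
- case=> z [Ez <-]; exists (val a ∘ (base (val a) ∘ z)); split; first exact: mem_elts.
  rewrite -Ez -comp_assoc; exact: mem_elts.
- case=> b [xb /memP [z [Ez Vz]]]; rewrite -Vz in xb; move/memP: xb => [z' [Ez' Vz']].
  by exists z'; rewrite -comp_assoc Ez'.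
Qed.

(** A subobject of the elements of [a] is small over them, because monos are
    small, hence small over [T]. *)
Lemma separation_set (T : C) (a : hom T V) (Q : sub (prod T V)) : exists y : hom T V,
  forall (U : C) (t : hom U T) (x : hom U V),
    mem x (y ∘ t) <-> mem x (a ∘ t) /\ sub_in Q (pair t x).
Proof.
pose Z := sub_pull (pair (base a) (val a)) Q.
have [y H] := small_set HS HM HV (val a ∘ sub_map Z)
  (small_comp HS (base_small a) (HM (@sub_mono _ _ Z))).
have inZ : forall (W : C) (z : hom W (elts a)), sub_in Z z <->
  sub_in Q (pair (base a ∘ z) (val a ∘ z)).
{ by move=> W z; rewrite sub_in_pull pair_comp. }
exists y => U t x; rewrite H; split.
- move=> L.
  have L' : locally (fun W k => mem (x ∘ k) (a ∘ t ∘ k) /\ sub_in Q (pair t x ∘ k)).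
  { apply: (loc_mono L) => W k [z [Ez Vz]].
    have /inZ : sub_in Z (sub_map Z ∘ z) by exists z.
    rewrite -comp_assoc -Vz pair_comp -Vz -Ez -!comp_assoc; split=> //.
    exact: mem_elts. }
  split; [apply: loc_mem | apply: loc_in];
    by apply: (loc_mono L') => W k [].
- case=> /memP [z [<- <-]] /inZ [z' Ez'].
  apply: loc_here; exists z'; by rewrite !comp_idr -!comp_assoc Ez'.
Qed.

(** The pairs [(t, x)] with [x] included in [a(t)]. *)
Definition power_candidates (T : C) (a : hom T V) : sub (prod T V) :=
  @sub_all C _ _ (@pr1 C (prod T V) V) (sub_imp
    (sub_pull (pair (coalg_map V ∘ (pr2 ∘ pr1)) pr2) (pow_mem (coalg_pow V)))
    (sub_pull (pair (coalg_map V ∘ (a ∘ (pr1 ∘ pr1))) pr2) (pow_mem (coalg_pow V)))).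

Lemma power_candidatesP (T : C) (a : hom T V) (U : C) (t : hom U T) (x : hom U V) :
  sub_in (power_candidates a) (pair t x) <->
  forall (W : C) (k : hom W U) (z : hom W V), mem z (x ∘ k) -> mem z (a ∘ (t ∘ k)).
Proof.
rewrite sub_in_all; split=> H W k z.
- have := H W k (pair (pair t x ∘ k) z); rewrite sub_in_imp; cat.
  move/(_ eq_refl _ (idm _)); rewrite !sub_in_pull; cat; exact.
- move=> E.
  have -> : z = pair (pair (t ∘ k) (x ∘ k)) (pr2 ∘ z).
  { by rewrite -[LHS]pair_eta E pair_comp. }
  rewrite sub_in_imp => W' k'; rewrite !sub_in_pull; cat; exact: H.
Qed.

End SetOperations.

(** * Power sets *)

Section SlicePower.
Variables (C : lexcat) (B : C).

Lemma slice_sub_inE (Y : slice B) (R : sub Y) (Z : slice B) (x : hom Z Y) :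
  sub_in R x <-> sub_in (Sub (slice_mono_mor (@sub_mono _ _ R))) (s_mor x).
Proof.
split.
- case=> h <-; by exists (s_mor h).
- case=> h /= Hh.
  have E : s_map (sub_ob R) ∘ h = s_map Z.
  { by rewrite (slice_map_comp (sub_map R)) Hh s_comm. }
  exists (@SliceHom C B Z (sub_ob R) h E); exact: slice_hom_eq.
Qed.

Lemma pb_is_pullback (X Y D : C) (f : hom X D) (g : hom Y D) :
  is_pullback (pb1 f g) (pb2 f g) f g.
Proof.
split; first exact: pb_comm.
move=> T u v E; exists (pb_pair E); split; first by rewrite pb_pair1 pb_pair2.
by move=> h [Eu Ev]; apply: pb_uniq; rewrite ?pb_pair1 ?pb_pair2.
Qed.

End SlicePower.

Section PowerSet.
Variables (C : heyting_pretopos) (S : arrows C) (N : nno C).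
Hypotheses (HS : small_maps S N) (HM : axiom_M S).
Variable V : coalgebra S.
Hypothesis HV : indexed_final_coalgebra V.
Variables (T : C) (a : hom T V).

Let Q := power_candidates a.
Let subset := pr2 ∘ sub_map Q.
Let X : slice T := SliceOb (base a).
Let P : slice T := SliceOb (pr1 ∘ sub_map Q).

(** The membership relation of a family of subsets of [a], which exhibits [P] as a
    powerclass of [X] in the slice over [T]. *)
Definition power_rel (I : slice T) (f : hom I P) : sub (prod I X) :=
  @slice_sub C T (prod I X)
    (sub_pull (pair (coalg_map V ∘ (subset ∘ (s_mor f ∘ s_mor (@pr1 (slice T) I X))))
                 (val a ∘ s_mor (@pr2 (slice T) I X)))
       (pow_mem (coalg_pow V))).

Lemma power_relP (I : slice T) (f : hom I P) (Z : slice T) (x : hom Z (prod I X)) :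
  sub_in (power_rel f) x <->
  mem (val a ∘ s_mor (pr2 ∘ x)) (subset ∘ s_mor (f ∘ (pr1 ∘ x))).
Proof. by rewrite slice_sub_in sub_in_pull pair_comp -!comp_assoc. Qed.

Lemma power_small (I : slice T) (f : hom I P) :
  small_rel (slice_arrows S (B:=T)) (power_rel f).
Proof.
apply: (small_comp HS).
- apply: (small_pullback HS (pb_is_pullback _ _)); exact: base_small.
- apply: HM; exact: sub_mono.
Qed.

Lemma power_nat (I J : slice T) (f : hom I P) (g : hom J I) :
  sub_eq (power_rel (f ∘ g)) (sub_pull (prodmap g (idm X)) (power_rel f)).
Proof.
have E : forall (Z : slice T) (x : hom Z (prod J X)), sub_in (power_rel (f ∘ g)) x <->
  sub_in (sub_pull (prodmap g (idm X)) (power_rel f)) x.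
{ by move=> Z x; rewrite sub_in_pull !power_relP /prodmap; cat. }
by split; apply/sub_leP => Z x; rewrite E.
Qed.

Lemma subsetP (U : C) (q : hom U Q) (W : C) (k : hom W U) (z : hom W V) :
  mem z (subset ∘ (q ∘ k)) -> mem z (a ∘ (pr1 ∘ (sub_map Q ∘ (q ∘ k)))).
Proof.
move=> Hz; have : sub_in Q (sub_map Q ∘ q) by exists q.
rewrite -(pair_eta (sub_map Q ∘ q)) => /power_candidatesP /(_ W k z); cat; apply.
by move: Hz; rewrite /subset; cat.
Qed.

Lemma power_inj (I : slice T) (f g : hom I P) :
  sub_eq (power_rel f) (power_rel g) -> f = g.
Proof.
have half : forall (f g : hom I P) W (k : hom W (s_dom I)) (z : hom W V),
  sub_le (power_rel f) (power_rel g) ->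
  mem z (subset ∘ s_mor f ∘ k) -> mem z (subset ∘ s_mor g ∘ k).
{ move=> {}f {}g W k z /sub_leP H Hz.
  have := Hz; rewrite -comp_assoc => /subsetP.
  have -> : pr1 ∘ (sub_map Q ∘ (s_mor f ∘ k)) = s_map I ∘ k.
  { by rewrite -(s_comm f) /= !comp_assoc. }
  move/memP => [u [Eu Vu]].
  pose W' : slice T := SliceOb (s_map I ∘ k).
  pose i : hom W' I := @SliceHom C T W' I k eq_refl.
  pose u' : hom W' X := @SliceHom C T W' X u Eu.
  have := H W' (pair i u'); rewrite !power_relP pr1_pair pr2_pair /= Vu !comp_assoc.
  exact. }
case=> H H'; apply: slice_hom_eq; apply: (@sub_mono _ _ Q); apply: prod_uniq.
- rewrite !comp_assoc; exact: (eq_trans (s_comm f) (eq_sym (s_comm g))).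
- rewrite !comp_assoc -/subset; apply: (mem_ext HS HM HV) => W k z.
  by split; apply: half.
Qed.

(** A small relation to the elements of [a] is in particular a small family in
    [V], so it is named by a set, and this set is included in [a]. *)
Lemma power_surj (I : slice T) (R : sub (prod I X)) :
  small_rel (slice_arrows S (B:=T)) R -> exists f : hom I P, sub_eq (power_rel f) R.
Proof.
move=> SR; pose r1 := s_mor (pr1 ∘ sub_map R); pose r2 := s_mor (pr2 ∘ sub_map R).
have [y Hy] := small_set HS HM HV (val a ∘ r2) (SR : S r1).
have r12 : base a ∘ r2 = s_map I ∘ r1.
{ exact: (eq_trans (s_comm (pr2 ∘ sub_map R)) (eq_sym (s_comm (pr1 ∘ sub_map R)))). }
have [q Hq] : sub_in Q (pair (s_map I) y).
{ apply/power_candidatesP => W k z /Hy L; apply: loc_mem; apply: (loc_mono L).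
  move=> W' k' [r [Er <-]]; rewrite -!comp_assoc -Er (comp_assoc (s_map I)) -r12.
  rewrite -!comp_assoc; exact: mem_elts. }
have Eq : s_map P ∘ q = s_map I by rewrite /= -comp_assoc Hq pr1_pair.
pose f : hom I P := @SliceHom C T I P q Eq.
exists f.
have E : forall (Z : slice T) (x : hom Z (prod I X)),
  sub_in (power_rel f) x <-> sub_in R x.
{ move=> Z x; rewrite power_relP slice_sub_inE.
  have -> : subset ∘ s_mor (f ∘ (pr1 ∘ x)) = y ∘ s_mor (pr1 ∘ x).
  { rewrite /subset /= comp_assoc -(comp_assoc pr2) Hq; by cat. }
  have x12 : base a ∘ s_mor (pr2 ∘ x) = s_map I ∘ s_mor (pr1 ∘ x).
  { exact: (eq_trans (s_comm (pr2 ∘ x)) (eq_sym (s_comm (pr1 ∘ x)))). }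
  rewrite Hy; split.
  - move=> L; apply: loc_in; apply: (loc_mono L) => W k [r [E1 E2]].
    have {}E2 : r2 ∘ r = s_mor (pr2 ∘ x) ∘ k.
    { have assoc : forall D (u : hom (elts a) D), u ∘ (r2 ∘ r) = (u ∘ r2) ∘ r /\
        u ∘ (s_mor (pr2 ∘ x) ∘ k) = (u ∘ s_mor (pr2 ∘ x)) ∘ k.
      { by move=> D u; split; apply: comp_assoc. }
      apply: elts_eq; [have [-> ->] := assoc _ (base a) | have [-> ->] := assoc _ (val a)];
        last exact: E2.
      rewrite r12 x12 -(comp_assoc _ r1) E1; exact: comp_assoc. }
    exists r; apply: pb_uniq; rewrite !comp_assoc; [exact: E1 | exact: E2].
  - case=> r Er; apply: loc_here; exists r; rewrite !comp_idr -comp_assoc.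
    have Er' : s_mor (sub_map R) ∘ r = s_mor x := Er.
    by split; [|congr (_ ∘ _)]; rewrite /r1 /r2 /= -comp_assoc Er'. }
by split; apply/sub_leP => Z x; rewrite E.
Qed.

Definition slice_powerclass : powerclass (slice_arrows S (B:=T)) X :=
  Powerclass power_small power_nat power_inj power_surj.

(** Small maps are stable under powerclasses, so the family of subsets of [a] is
    small over [T]. *)
Lemma power_set (HP2 : axiom_P2 S) : exists y : hom T V,
  forall (U : C) (t : hom U T) (x : hom U V), mem x (y ∘ t) <->
    forall (W : C) (k : hom W U) (z : hom W V), mem z (x ∘ k) -> mem z (a ∘ (t ∘ k)).
Proof.
have Sp : S (pr1 ∘ sub_map Q) by exact: (HP2 T X (base_small a) slice_powerclass).
have [y Hy] := small_set HS HM HV subset Sp.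
exists y => U t x; rewrite Hy -power_candidatesP; split.
- move=> L; apply: loc_in; apply: (loc_mono L) => W k [q [Eq Vq]].
  by exists q; rewrite pair_comp -Eq -Vq -!comp_assoc pair_eta.
- case=> q Eq; apply: loc_here; exists q.
  by rewrite /subset -!comp_assoc Eq pr1_pair pr2_pair !comp_idr.
Qed.

End PowerSet.

(** * Ordered pairs and colourings of graphs *)

Section OrderedPairs.
Variables (C : heyting_pretopos) (S : arrows C) (N : nno C).
Hypotheses (HS : small_maps S N) (HM : axiom_M S).
Variable V : coalgebra S.
Hypothesis HV : indexed_final_coalgebra V.
Variable up : hom (prod V V) V.
Hypothesis Hup : forall (U : C) (x y z : hom U V), mem z (up ∘ pair x y) <->
  locally (fun W (k : hom W U) => z ∘ k = x ∘ k \/ z ∘ k = y ∘ k).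

Definition opair (T : C) (x y : hom T V) : hom T V :=
  up ∘ pair (up ∘ pair x x) (up ∘ pair x y).

Lemma opair_comp (T U : C) (x y : hom T V) (f : hom U T) :
  opair x y ∘ f = opair (x ∘ f) (y ∘ f).
Proof. by rewrite /opair; cat. Qed.

Lemma mem_singleton (T : C) (x z : hom T V) : mem z (up ∘ pair x x) <-> z = x.
Proof.
rewrite Hup; split; last by move->; apply: loc_here; left.
by move=> L; apply: (loc_eq L) => W k [].
Qed.

Lemma mem_upair_l (T : C) (x y : hom T V) : mem x (up ∘ pair x y).
Proof. by apply/Hup; apply: loc_here; left. Qed.
Lemma mem_upair_r (T : C) (x y : hom T V) : mem y (up ∘ pair x y).
Proof. by apply/Hup; apply: loc_here; right. Qed.

(** The union of [{{x}, {x, y}}] is [{x, y}].  With it the second components of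
    equal pairs are compared without distinguishing whether [x = y]. *)
Lemma opair_union (T : C) (x y z : hom T V) : mem z (up ∘ pair x y) <->
  locally (fun U k => exists s, mem s (opair x y ∘ k) /\ mem (z ∘ k) s).
Proof.
split.
- move=> H; apply: loc_here; exists (up ∘ pair x y); rewrite !comp_idr; split=> //.
  exact: mem_upair_r.
- move=> L; apply: loc_mem; apply: (loc_bind L) => U k [s []].
  rewrite opair_comp Hup => Ls zs; apply: (loc_mono Ls) => W l; rewrite !comp_assoc.
  move: zs => /(mem_comp l) zs [] E; rewrite E in zs; move: zs; cat => // /mem_singleton ->.
  exact: mem_upair_l.
Qed.

Lemma opair_inj_l (T : C) (x y x' y' : hom T V) : opair x y = opair x' y' -> x = x'.
Proof.
move=> E.
have : mem (up ∘ pair x x) (opair x' y') by rewrite -E; exact: mem_upair_l.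
rewrite Hup => L; apply: (loc_eq L) => U k H; symmetry; apply/mem_singleton.
rewrite -pair_comp comp_assoc.
case: H => ->; cat; exact: mem_upair_l.
Qed.

Lemma opair_inj (T : C) (x y x' y' : hom T V) :
  opair x y = opair x' y' -> x = x' /\ y = y'.
Proof.
move=> E; have Ex := opair_inj_l E; split=> //; subst x'.
have Eu : up ∘ pair x y = up ∘ pair x y'.
{ apply: (mem_ext HS HM HV) => U t z; cat; rewrite !opair_union -!opair_comp E.
  by []. }
have /Hup L : mem y (up ∘ pair x y') by rewrite -Eu; exact: mem_upair_r.
have /Hup L' : mem y' (up ∘ pair x y) by rewrite Eu; exact: mem_upair_r.
apply: (loc_eq L) => U k [] // Ey.
apply: (loc_eq (loc_sieve L' k)) => W l [X [m [n [H El]]]].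
rewrite Ey -!comp_assoc El !comp_assoc; case: H => -> //.
by rewrite -!comp_assoc -El !comp_assoc Ey.
Qed.


(** The colouring equation for a map on nodes, where [e] is a set of pairs. *)
Definition decorates (T : C) (n e : hom T V) (c : hom (elts n) V) : Prop :=
  forall (U : C) (x : hom U (elts n)) (y : hom U V),
    mem y (c ∘ x) <-> locally (fun W k => exists x' : hom W (elts n),
      base n ∘ x' = base n ∘ (x ∘ k) /\
      mem (opair (val n ∘ (x ∘ k)) (val n ∘ x')) (e ∘ (base n ∘ (x ∘ k))) /\
      c ∘ x' = y ∘ k).

(** The edges of the graph form a subobject of the pairs of nodes over the same
    point of [T].  The projection of such pairs to their first node is a pullback
    of a small map, and the inclusion is mono, so the graph is a coalgebra. *)
Lemma decoration (T : C) (n e : hom T V) : exists! c : hom (elts n) V, decorates e c.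
Proof.
pose p1 := pb1 (base n) (base n); pose p2 := pb2 (base n) (base n).
pose Z := sub_pull (pair (coalg_map V ∘ (e ∘ (base n ∘ p1)))
  (opair (val n ∘ p1) (val n ∘ p2))) (pow_mem (coalg_pow V)).
have ZP : forall (W : C) (x x' : hom W (elts n)),
  (exists z : hom W Z, p1 ∘ sub_map Z ∘ z = x /\ p2 ∘ sub_map Z ∘ z = x') <->
  base n ∘ x' = base n ∘ x /\
  mem (opair (val n ∘ x) (val n ∘ x')) (e ∘ (base n ∘ x)).
{ move=> W x x'; split.
  - case=> z [<- <-]; split; first by rewrite !comp_assoc pb_comm.
    have : sub_in Z (sub_map Z ∘ z) by exists z.
    by rewrite sub_in_pull pair_comp opair_comp -!comp_assoc.
  - case=> E H.
    have [z Hz] : sub_in Z (pb_pair (eq_sym E)).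
    { apply/sub_in_pull; rewrite pair_comp opair_comp -!comp_assoc.
      by rewrite !pb_pair1 !pb_pair2. }
    by exists z; rewrite -!comp_assoc Hz pb_pair1 pb_pair2. }
have Sg : S (p1 ∘ sub_map Z).
{ apply: (small_comp HS); last by apply: HM; exact: sub_mono.
  apply: (small_pullback HS (pb_is_pullback _ _)); exact: base_small. }
have E : forall (c : hom (elts n) V), decorates e c <->
  forall (U : C) (x : hom U (elts n)) (y : hom U V), mem y (c ∘ x) <->
    locally (fun W k => exists z : hom W Z, p1 ∘ sub_map Z ∘ z = x ∘ k /\
      c ∘ (p2 ∘ sub_map Z ∘ z) = y ∘ k).
{ move=> c.
  have L : forall (U : C) (x : hom U (elts n)) (y : hom U V),
    locally (fun W k => exists x' : hom W (elts n),
      base n ∘ x' = base n ∘ (x ∘ k) /\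
      mem (opair (val n ∘ (x ∘ k)) (val n ∘ x')) (e ∘ (base n ∘ (x ∘ k))) /\
      c ∘ x' = y ∘ k) <->
    locally (fun W k => exists z : hom W Z, p1 ∘ sub_map Z ∘ z = x ∘ k /\
      c ∘ (p2 ∘ sub_map Z ∘ z) = y ∘ k).
  { move=> U x y; split=> L; apply: (loc_mono L) => W k.
    - case=> x' [Ex [Hx <-]]; have [z [Ez <-]] := proj2 (ZP _ _ _) (conj Ex Hx).
      by exists z.
    - case=> z [Ez <-]; exists (p2 ∘ sub_map Z ∘ z).
      have [] := proj1 (ZP W (x ∘ k) (p2 ∘ sub_map Z ∘ z)); last by split.
      by exists z. }
  by split=> H U x y; rewrite H L. }
have [c [Hc cU]] := graph_colouring HS HM HV (p2 ∘ sub_map Z) Sg.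
by exists c; split; [apply/E | move=> c' /E; apply: cU].
Qed.

(** The formula [is_colouring], unfolded on generalized elements; the equivalence
    is [forces_is_colouring]. *)
Definition colours (T : C) (c n e : hom T V) : Prop :=
  (forall (U : C) (f : hom U T) (z : hom U V), mem z (c ∘ f) ->
    locally (fun W k => exists x u : hom W V,
      mem x (n ∘ (f ∘ k)) /\ z ∘ k = opair x u)) /\
  (forall (U : C) (f : hom U T) (x : hom U V), mem x (n ∘ f) ->
    exists u : hom U V, forall (W : C) (k : hom W U) (y : hom W V),
      mem (opair (x ∘ k) y) (c ∘ (f ∘ k)) <-> y = u ∘ k) /\
  (forall (U : C) (f : hom U T) (x u : hom U V), mem x (n ∘ f) ->
    mem (opair x u) (c ∘ f) -> forall y : hom U V, mem y u <->
    locally (fun W k => exists x' : hom W V,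
      mem (opair (x ∘ k) x') (e ∘ (f ∘ k)) /\
      mem (opair x' (y ∘ k)) (c ∘ (f ∘ k)))).

(** A function in the sense of sets is evaluated at the generic element of [n]
    to give a map on the object of elements of [n]. *)
Lemma colours_decoration (T : C) (c n e : hom T V) : colours c n e ->
  exists d : hom (elts n) V, decorates e d /\
    forall (U : C) (x : hom U (elts n)) (u : hom U V),
      mem (opair (val n ∘ x) u) (c ∘ (base n ∘ x)) <-> u = d ∘ x.
Proof.
move=> [pairs [total eqn]].
have [d Hd] := total _ (base n) (val n) (mem_val n).
exists d; split=> // U x y.
have Hx : mem (opair (val n ∘ x) (d ∘ x)) (c ∘ (base n ∘ x)) by apply/Hd.
rewrite (eqn _ _ _ _ (mem_elts x) Hx); split=> L.
- apply: (loc_bind L) => W k [x' [He Hc]].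
  apply: (loc_mono (pairs _ _ _ Hc)) => W' l [v [u [Hv]]].
  rewrite opair_comp => /opair_inj [Ev _]; rewrite -{}Ev in Hv.
  move/memP: Hv => [z [Ez Vz]].
  exists z; rewrite Ez -!comp_assoc; split=> //; split.
  + rewrite Vz; move: He => /(mem_comp l); by rewrite opair_comp -!comp_assoc.
  + symmetry; apply/Hd; rewrite Vz Ez.
    move: Hc => /(mem_comp l); by rewrite opair_comp -!comp_assoc.
- apply: (loc_mono L) => W k [x' [Ex [He Ey]]]; exists (val n ∘ x'); split.
  + by rewrite -!comp_assoc.
  + rewrite -!comp_assoc -Ex -Ey; exact/Hd.
Qed.

(** Both colourings come from decorations, which are equal, and a set of pairs is
    determined by the map of which it is the graph. *)
Lemma colours_unique (T : C) (c c' n e : hom T V) :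
  colours c n e -> colours c' n e -> c = c'.
Proof.
have half : forall c c' : hom T V, colours c n e -> colours c' n e ->
  forall (U : C) (t : hom U T) (z : hom U V), mem z (c ∘ t) -> mem z (c' ∘ t).
{ move=> {}c {}c' Hc Hc' U t z Hz.
  have [d [dD Hd]] := colours_decoration Hc.
  have [d' [dD' Hd']] := colours_decoration Hc'.
  have [d0 [_ dU]] := decoration n e.
  have Ed : d = d' by rewrite -(dU d) // -(dU d').
  apply: loc_mem; have [pairs _] := Hc.
  apply: (loc_mono (pairs _ _ _ Hz)) => W k [x [u [/memP [v [Ev <-]] Ez]]].
  rewrite Ez -comp_assoc -Ev; apply/Hd'; rewrite -Ed; apply/Hd.
  by rewrite Ev -Ez comp_assoc; apply: mem_comp. }
move=> Hc Hc'; apply: (mem_ext HS HM HV) => U t z; split; exact: half.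
Qed.

(** The graph [{(x, d x) | x in n}] of the decoration [d] is a small family, being
    indexed by the elements of [n]. *)
Lemma colours_exists (T : C) (n e : hom T V) : exists c, colours c n e.
Proof.
have [d [dD _]] := decoration n e.
have [c Hc] := small_set HS HM HV (opair (val n) d) (base_small n).
have Hd : forall (U : C) (x : hom U (elts n)) (u : hom U V),
  mem (opair (val n ∘ x) u) (c ∘ (base n ∘ x)) <-> u = d ∘ x.
{ move=> U x u; rewrite Hc; split.
  - move=> L; apply: (loc_eq L) => W k [z [Ez]]; rewrite !opair_comp.
    move/opair_inj => [Ev <-].
    suff -> : z = x ∘ k by rewrite comp_assoc.
    by apply: elts_eq; rewrite comp_assoc.
  - move->; apply: loc_here; exists x; by rewrite !comp_idr opair_comp. }
exists c; split; last split.
- move=> U f z /Hc L; apply: (loc_mono L) => W k [x [Ex Vx]].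
  exists (val n ∘ x), (d ∘ x); rewrite -opair_comp Vx -Ex; split=> //.
  exact: mem_elts.
- move=> U f x /memP [v [Ev <-]]; exists (d ∘ v) => W k y.
  by rewrite -!comp_assoc -Hd -Ev -!comp_assoc.
- move=> U f x u /memP [v [Ev <-]]; rewrite -Ev => /Hd -> y.
  rewrite dD; split=> L.
  + apply: (loc_mono L) => W k [x' [Ex [He Ey]]]; exists (val n ∘ x').
    rewrite -!comp_assoc; split=> //; rewrite -Ex -Ey; exact/Hd.
  + apply: (loc_bind L) => W k [x' [He Hx]].
    have L' := Hx; rewrite Hc in L'; apply: (loc_mono L') => W' l [z [Ez]].
    rewrite !opair_comp => /opair_inj [Vz Dz].
    exists z; rewrite Ez -!comp_assoc; split=> //; split.
    * rewrite Vz; move: He => /(mem_comp l); by rewrite opair_comp -!comp_assoc.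
    * by rewrite Dz -!comp_assoc.
Qed.

End OrderedPairs.

(** * Natural numbers *)

(** Recursion into [A], followed by the inclusion of [A], satisfies the same
    recursion equations as the identity, so the inclusion has a section. *)
Lemma nno_induction (C : lexcat) (N : nno C) (T : C) (A : sub (prod T N)) :
  sub_in A (pair (idm T) (nno_zero N ∘ bang T)) ->
  sub_in A (prodmap (idm T) (nno_succ N) ∘ sub_map A) ->
  forall (U : C) (x : hom U (prod T N)), sub_in A x.
Proof.
move=> [f Hf] [s Hs] U x.
have [r [[r0 rs] _]] := @nno_rec _ N _ _ f (s ∘ @pr2 C T A).
have [k [_ kU]] := @nno_rec _ N _ _ (pair (idm T) (nno_zero N ∘ bang T))
  (prodmap (idm T) (nno_succ N) ∘ @pr2 C T (prod T N)).
have E1 : k = idm _.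
{ apply: kU; split; first by rewrite comp_idl.
  by rewrite comp_idl -comp_assoc pr2_pair comp_idr. }
have E2 : k = sub_map A ∘ r.
{ apply: kU; split; first by rewrite -comp_assoc r0.
  by rewrite -!comp_assoc rs -!comp_assoc !pr2_pair !comp_assoc Hs. }
by exists (r ∘ x); rewrite comp_assoc -E2 E1 comp_idl.
Qed.

Section Numerals.
Variables (C : heyting_pretopos) (S : arrows C) (N : nno C).
Hypotheses (HS : small_maps S N) (HM : axiom_M S).
Variable V : coalgebra S.
Hypothesis HV : indexed_final_coalgebra V.

(** The von Neumann numerals, when [o] is the empty set and [s] the successor. *)
Lemma numerals (o : hom one V) (s : hom V V) : exists num : hom N V,
  num ∘ nno_zero N = o /\ num ∘ nno_succ N = s ∘ num.
Proof.
have [r [[r0 rs] _]] := @nno_rec _ N _ _ o (s ∘ @pr2 C one V).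
exists (r ∘ pair (bang N) (idm N)); split.
- rewrite -r0; cat; congr (_ ∘ pair _ _); first exact: bang_uniq.
  rewrite -{1}(comp_idr (nno_zero N)); congr (_ ∘ _); exact: bang_uniq.
- have := f_equal (fun u => u ∘ pair (bang N) (idm N)) rs; cat => H.
  rewrite -H; congr (_ ∘ pair _ _); exact: bang_uniq.
Qed.

Lemma numeral_set (num : hom N V) : exists w : hom one V,
  forall (U : C) (t : hom U one) (x : hom U V), mem x (w ∘ t) <->
    locally (fun W k => exists n : hom W N, num ∘ n = x ∘ k).
Proof.
have [w Hw] := small_set HS HM HV num (small_nno HS).
exists w => U t x; rewrite Hw; split=> L; apply: (loc_mono L) => W k.
- by case=> n [_ E]; exists n.
- case=> n E; exists n; split=> //; exact: bang_uniq.
Qed.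

End Numerals.

(** * Validity of the theory *)

Section Validity.
Variables (C : heyting_pretopos) (S : arrows C) (N : nno C).
Hypotheses (HS : small_maps S N) (HM : axiom_M S).
Variable V : coalgebra S.
Hypothesis HV : indexed_final_coalgebra V.
Variable w : hom one (coalg_ob V).

(** Extensionality, in the form in which the formulas for the empty set, successors
    and pairs are evaluated. *)
Lemma forces_comprehension n (t : term n) (phi : form (Datatypes.S n)) (T : C)
    (rho : Fin.t n -> hom T V) (y : hom T V) :
  (forall (U : C) (f : hom U T) (x : hom U V),
     forces w phi (scons x (restrict rho f)) <-> mem x (y ∘ f)) ->
  forces w (All (Iff (Mem v0 (lift t)) phi)) rho <-> eval w rho t = y.
Proof.
move=> E; rewrite forces_all_iff; split=> [H|H U f x].
- by apply: (mem_ext HS HM HV) => U f x; rewrite -forces_mem_lift H E.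
- by rewrite forces_mem_lift E H.
Qed.

Lemma forces_excluded_middle (HB : boolean C) n (phi : form n) (T : C)
  (rho : Fin.t n -> hom T V) : forces w (ExcludedMiddle phi) rho.
Proof.
have [B [/sub_leP disj /sub_leP top]] := HB _ (interp w phi).
have /top /sub_in_or L : sub_in (sub_top _) (tuple rho).
{ by exists (tuple rho); rewrite comp_idl. }
apply: (loc_mono L) => U f; rewrite tuple_comp => -[/forces_interp|HB']; first by left.
right=> W g /forces_interp H.
have : sub_in (sub_and (interp w phi) B) (tuple (restrict (restrict rho f) g)).
{ apply/sub_in_and; split=> //; rewrite -tuple_comp; exact: sub_in_comp. }
by move/disj/sub_in_bot.
Qed.

Lemma forces_extensionality (T : C) (rho : Fin.t 2 -> hom T V) :
  forces w Extensionality rho.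
Proof.
move=> U f /forces_all_iff H; apply: (mem_ext HS HM HV) => W t z; exact: H.
Qed.

Lemma forces_pairing (T : C) (rho : Fin.t 2 -> hom T V) : forces w Pairing rho.
Proof.
have [up Hup] := unordered_pair HS HM HV.
apply: (forces_here_ex (x := up ∘ pair (rho (FS F1)) (rho F1))).
apply/forces_all_iff => U f x /=; rewrite /restrict /= -(comp_assoc up) pair_comp Hup.
by apply: loc_iff => W k.
Qed.

Lemma forces_union (T : C) (rho : Fin.t 1 -> hom T V) : forces w Union rho.
Proof.
have [y Hy] := union_set HS HM HV (rho F1).
apply: (forces_here_ex (x := y)); apply/forces_all_iff => U f x /=.
rewrite /restrict /= Hy; apply: loc_iff => W k.
by split=> -[b Hb]; exists b; move: Hb; rewrite /= !comp_assoc.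
Qed.

Lemma forces_emptyset (T : C) (rho : Fin.t 0 -> hom T V) : forces w Emptyset rho.
Proof.
have [o Ho] := empty_set HS HM HV.
apply: (forces_here_ex (x := o ∘ bang T)); apply/forces_all_iff => U f x /=.
by rewrite /restrict /= -comp_assoc Ho.
Qed.

Lemma forces_separation n (x : Fin.t n) (phi : form (Datatypes.S n)) (T : C)
  (rho : Fin.t n -> hom T V) : forces w (Separation x phi) rho.
Proof.
pose R := sub_pull (tuple (scons pr2 (restrict rho (@pr1 C T V)))) (interp w phi).
have RP : forall (U : C) (t : hom U T) (z : hom U V),
  sub_in R (pair t z) <-> forces w phi (scons z (restrict rho t)).
{ move=> U t z; rewrite sub_in_pull tuple_comp -forces_interp restrict_scons.
  by rewrite restrict_comp pr1_pair pr2_pair. }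
have [y Hy] := separation_set HS HM HV (rho x) R.
apply: (forces_here_ex (x := y)); apply/forces_all_iff => U f z.
rewrite forces_And forces_ren /=.
have -> : (fun i => scons z (restrict (scons y rho) f) (scons F1 (fun i => FS (FS i)) i))
  = scons z (restrict rho f) by env_eq.
by rewrite /restrict /= Hy RP.
Qed.

Lemma forces_intersection (T : C) (rho : Fin.t 2 -> hom T V) :
  forces w Intersection rho.
Proof.
have := @forces_separation 2 (FS F1) (Mem v0 v1 : form 3) T rho.
exact.
Qed.

(** Unique choice at the generic element of [a] gives a map [F] on the elements of
    [a], and the set sought is the family of its values. *)
Lemma forces_replacement n (a : Fin.t n) (phi : form (Datatypes.S (Datatypes.S n)))
  (T : C) (rho : Fin.t n -> hom T V) : forces w (Replacement a phi) rho.
Proof.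
move=> U f; set sigma := restrict rho f => /forces_AllIn H.
have /forces_ExU [F HF] := H _ _ _ (mem_val (sigma a)).
have [z Hz] := small_set HS HM HV F (base_small (sigma a)).
apply: (forces_here_ex (x := z)); apply/forces_all_iff => W k y.
rewrite forces_ExIn /= [in X in X <-> _]/restrict /= Hz; apply: loc_iff => X l.
have E : forall x, (fun i => scons x (restrict (scons y (restrict (scons z sigma) k)) l)
    (scons (FS F1) (scons F1 (fun i => FS (FS (FS i)))) i)) =
  scons (y ∘ l) (scons x (restrict sigma (k ∘ l))).
{ move=> x; rewrite -restrict_comp; env_eq. }
have F' : forall q : hom X (elts (sigma a)), base (sigma a) ∘ q = k ∘ l ->
  forces w phi (scons (y ∘ l) (scons (val (sigma a) ∘ q) (restrict sigma (k ∘ l)))) <->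
  y ∘ l = F ∘ q.
{ by move=> q Eq; rewrite -HF restrict_scons restrict_comp Eq. }
rewrite /restrict /= -(comp_assoc _ k l); split.
- case=> q [Eq Fq]; exists (val (sigma a) ∘ q); split.
  + rewrite -Eq; exact: mem_elts.
  + rewrite forces_ren E; apply/F' => //.
- case=> x [/memP [q [Eq <-]]]; rewrite forces_ren E => /(F' _ Eq) ->.
  by exists q.
Qed.

Lemma forces_powerset (HP2 : axiom_P2 S) (T : C) (rho : Fin.t 1 -> hom T V) :
  forces w Powerset rho.
Proof.
have [y Hy] := power_set HS HM HV (rho F1) HP2.
apply: (forces_here_ex (x := y)); apply/forces_all_iff => U f x.
rewrite forces_AllIn /= /restrict /= Hy; split=> H W k z;
  have := H W k z; by rewrite -comp_assoc.
Qed.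

(** The witnesses exist on a cover [Y] of the object of elements of [a].  The
    collection property replaces this cover, after passing to a cover [B] of the
    stage, by a map [Z -> B] that is small, and the set sought is the family of
    witnesses over [Z]. *)
Lemma forces_collection (HC : axiom_C S) n (x : Fin.t n)
    (phi : form (Datatypes.S (Datatypes.S n))) (T : C) (rho : Fin.t n -> hom T V) :
  forces w (Collection x phi) rho.
Proof.
move=> T' f'; set sigma := restrict rho f' => /forces_AllIn H.
pose a := sigma x.
have L := H _ _ _ (mem_val a).
pose env := scons (@pr2 C (elts a) V)
  (restrict (scons (val a) (restrict sigma (base a))) pr1).
pose Y := sub_pull (tuple env) (interp w phi).
pose p := pr1 ∘ sub_map Y.
have YP : forall (W : C) (q : hom W (elts a)) (y : hom W V), sub_in Y (pair q y) <->
  forces w phi (scons y (scons (val a ∘ q) (restrict sigma (base a ∘ q)))).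
{ move=> W q y; rewrite sub_in_pull tuple_comp -forces_interp /env !restrict_scons.
  by rewrite !restrict_comp -!comp_assoc pr1_pair pr2_pair. }
(* [Y] covers the elements of [a] because the witnesses exist locally. *)
have Hp : epi p.
{ apply: locally_surjective_epi; apply: (loc_mono L) => W q [y].
  rewrite restrict_scons restrict_comp => /YP [r Hr].
  by exists r; rewrite /p -comp_assoc Hr pr1_pair. }
have [Z [B [k [g [h [Hh [Sg [e He]]]]]]]] := HC _ _ _ p (base a) Hp (base_small a).
have [z Hz] := small_set HS HM HV (pr2 ∘ sub_map Y ∘ k) Sg.
apply: (loc_mono (epi_locally_surjective HS HM (idm T') Hh)) => U t [b Eb].
rewrite comp_idl in Eb; exists (z ∘ b).
change (forces w (AllIn (lift (Var x)) (ExIn v1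
  (ren phi (scons F1 (scons (FS F1) (fun i => FS (FS (FS i))))))))
  (scons (z ∘ b) (restrict sigma t))).
apply/forces_AllIn => W l y.
rewrite eval_lift eval_restrict -comp_assoc.
move/(memP a) => [q [Eq Vq]]; apply/forces_ExIn.
have Eqb : base a ∘ q = h ∘ (b ∘ l) by rewrite comp_assoc Eb.
(* The square is a quasi-pullback: an element of [a] over a point of [B] lifts
   to [Z] on a cover. *)
have Ls := epi_locally_surjective HS HM (pb_pair Eqb) He.
apply: (loc_mono Ls) => W' m [c Ec].
have Ec1 : p ∘ k ∘ c = q ∘ m.
{ by rewrite -(pb_pair1 e) -comp_assoc Ec comp_assoc pb_pair1. }
have Ec2 : g ∘ c = b ∘ l ∘ m.
{ by rewrite -(pb_pair2 e) -comp_assoc Ec comp_assoc pb_pair2. }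
exists (pr2 ∘ sub_map Y ∘ k ∘ c); split.
- rewrite /= /restrict /= -!(comp_assoc z) Hz; apply: loc_here; exists c.
  by rewrite !comp_idr Ec2.
- rewrite forces_ren.
  set u := pr2 ∘ _ ∘ _ ∘ _.
  have -> : (fun i => scons u (restrict (scons y (restrict (scons (z ∘ b)
      (restrict sigma t)) l)) m) (scons F1 (scons (FS F1) (fun i => FS (FS (FS i)))) i)) =
    scons u (scons (val a ∘ (q ∘ m)) (restrict sigma (base a ∘ (q ∘ m)))).
  { rewrite !comp_assoc Vq Eq -!restrict_comp; env_eq. }
  apply/YP; exists (k ∘ c); rewrite -[LHS]pair_eta; congr (pair _ _).
  + by rewrite -Ec1 /p -!comp_assoc.
  + by rewrite /u -!comp_assoc.
Qed.

Section Infinity.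
Variables (o : hom one V) (s : hom V V) (num : hom N V).
Hypothesis Ho : forall (U : C) (t : hom U one) (x : hom U V),
  mem x (o ∘ t) <-> locally (fun W (_ : hom W U) => False).
Hypothesis Hs : forall (U : C) (x z : hom U V), mem z (s ∘ x) <->
  locally (fun W (k : hom W U) => mem (z ∘ k) (x ∘ k) \/ z ∘ k = x ∘ k).
Hypothesis num0 : num ∘ nno_zero N = o.
Hypothesis numS : num ∘ nno_succ N = s ∘ num.
Hypothesis Hw : forall (U : C) (t : hom U one) (x : hom U V), mem x (w ∘ t) <->
  locally (fun W k => exists n : hom W N, num ∘ n = x ∘ k).

Lemma forces_is_empty n (t : term n) (T : C) (rho : Fin.t n -> hom T V) :
  forces w (is_empty t) rho <-> eval w rho t = o ∘ bang T.
Proof.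
by apply: forces_comprehension => U f x; rewrite -comp_assoc Ho.
Qed.

Lemma forces_is_succ n (t u : term n) (T : C) (rho : Fin.t n -> hom T V) :
  forces w (is_succ t u) rho <-> eval w rho t = s ∘ eval w rho u.
Proof.
apply: forces_comprehension => U f x; rewrite -comp_assoc Hs forces_Or.
apply: loc_iff => W k.
by rewrite restrict_scons restrict_comp /= !eval_lift !eval_restrict !comp_assoc.
Qed.

Lemma forces_infinity1 (T : C) (rho : Fin.t 0 -> hom T V) : forces w Infinity1 rho.
Proof.
rewrite /Infinity1 forces_And; split.
- apply: (forces_here_ex (x := o ∘ bang T)); rewrite forces_And forces_is_empty.
  split=> //=; apply/Hw; apply: loc_here; exists (nno_zero N ∘ bang T).
  by rewrite comp_idr comp_assoc num0.
- apply/forces_AllIn => U f x; rewrite -comp_assoc => Hx.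
  apply: (forces_here_ex (x := s ∘ x)); rewrite forces_And forces_is_succ.
  split=> //=; apply/Hw; have {}Hx := proj1 (Hw _ _) Hx.
  apply: (loc_mono Hx) => W k [n En]; exists (nno_succ N ∘ n).
  by rewrite comp_assoc numS -!comp_assoc En.
Qed.

(** The induction formula, pulled back along the numerals, is a subobject of
    [U x N]; every element of omega is locally a numeral. *)
Lemma forces_infinity2 n (psi : form (Datatypes.S n)) (T : C)
  (rho : Fin.t n -> hom T V) : forces w (Infinity2 psi) rho.
Proof.
move=> U f; set sigma := restrict rho f => /forces_And [Hz Hsucc].
have {}Hsucc := proj1 (forces_AllIn _ _ _ _) Hsucc.
have {}Hz := proj1 (forces_Ex _ _ _) Hz.
pose A := sub_pull (tuple (scons (num ∘ pr2) (restrict sigma (@pr1 C U N))))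
  (interp w psi).
have AP : forall (W : C) (t : hom W U) (m : hom W N), sub_in A (pair t m) <->
  forces w psi (scons (num ∘ m) (restrict sigma t)).
{ move=> W t m; rewrite sub_in_pull tuple_comp -forces_interp restrict_scons.
  by rewrite restrict_comp -comp_assoc pr1_pair pr2_pair. }
have all : forall (W : C) (x : hom W (prod U N)), sub_in A x.
{ apply: nno_induction.
  - apply/AP; rewrite comp_assoc num0 restrict_idm; apply: loc_forces.
    apply: (loc_mono Hz) => W k [x]; rewrite forces_And forces_is_empty /= => -[-> H].
    by rewrite restrict_scons -comp_assoc (bang_uniq (bang U ∘ k) (bang W)).
  - rewrite -(pair_eta (sub_map A)) prodmap_pair comp_idl; apply/AP.
    have : sub_in A (sub_map A) by exact: sub_in_map.
    set t := pr1 ∘ sub_map A; set m := pr2 ∘ sub_map A.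
    rewrite -{1}(pair_eta (sub_map A)) => /AP H.
    have Hm : mem (num ∘ m) (eval w sigma Omega ∘ t).
    { rewrite /= -comp_assoc; apply/Hw; apply: loc_here; exists m; by rewrite comp_idr. }
    have Hn : forces w (Ex (And (is_succ v0 v1) (ren psi (scons F1 (fun i => FS (FS i))))))
      (scons (num ∘ m) (restrict sigma t)).
    { have := Hsucc _ _ _ Hm (sub_ob A) (idm _); rewrite restrict_idm; exact. }
    have {}Hn := proj1 (forces_Ex _ _ _) Hn.
    apply: loc_forces; apply: (loc_mono Hn) => W k [y].
    rewrite forces_And forces_is_succ forces_ren /= => -[Ey Hy].
    have -> : restrict (scons (num ∘ (nno_succ N ∘ m)) (restrict sigma t)) k =
      (fun i => scons y (restrict (scons (num ∘ m) (restrict sigma t)) k)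
        (scons F1 (fun i => FS (FS i)) i)); last exact: Hy.
    have {}Ey : y = num ∘ (nno_succ N ∘ m) ∘ k.
    { by rewrite Ey (comp_assoc num) numS /restrict /= !comp_assoc. }
    rewrite restrict_scons Ey; env_eq. }
apply/forces_AllIn => W k x; rewrite -comp_assoc => /Hw L.
apply: loc_forces; apply: (loc_mono L) => X l [m Em].
rewrite restrict_scons restrict_comp -Em; apply/AP; exact: all.
Qed.

End Infinity.

Section AntiFoundation.
Variable up : hom (prod V V) V.
Hypothesis Hup : forall (U : C) (x y z : hom U V), mem z (up ∘ pair x y) <->
  locally (fun W (k : hom W U) => z ∘ k = x ∘ k \/ z ∘ k = y ∘ k).

Lemma forces_is_upair n (t a b : term n) (T : C) (rho : Fin.t n -> hom T V) :
  forces w (is_upair t a b) rho <->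
  eval w rho t = up ∘ pair (eval w rho a) (eval w rho b).
Proof.
apply: forces_comprehension => U f x; rewrite -comp_assoc pair_comp Hup forces_Or.
apply: loc_iff => W k.
by rewrite restrict_scons restrict_comp /= !eval_lift !eval_restrict !comp_assoc.
Qed.

Lemma forces_is_pair n (t a b : term n) (T : C) (rho : Fin.t n -> hom T V) :
  forces w (is_pair t a b) rho <->
  eval w rho t = opair up (eval w rho a) (eval w rho b).
Proof.
apply: forces_comprehension => U f x; rewrite opair_comp Hup forces_Or.
apply: loc_iff => W k.
rewrite restrict_scons restrict_comp !forces_is_upair /= !eval_lift !eval_restrict.
by cat.
Qed.

Lemma forces_pair_in n (t a b : term n) (T : C) (rho : Fin.t n -> hom T V) :
  forces w (pair_in a b t) rho <->
  mem (opair up (eval w rho a) (eval w rho b)) (eval w rho t).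
Proof.
have E : forall (U : C) (f : hom U T) (x : hom U V),
  forces w (And (is_pair v0 (lift a) (lift b)) (Mem v0 (lift t)))
    (scons x (restrict rho f)) <->
  x = opair up (eval w rho a) (eval w rho b) ∘ f /\ mem x (eval w rho t ∘ f).
{ move=> U f x; rewrite forces_And forces_is_pair /= !eval_lift !eval_restrict.
  by rewrite opair_comp. }
split.
- move=> L; apply: loc_mem; apply: (loc_mono L) => U f [x /E [-> H]]; exact: H.
- move=> H; apply: loc_here; exists (opair up (eval w rho a) (eval w rho b)).
  by apply/E; rewrite !comp_idr.
Qed.

Lemma forces_is_colouring n (c a e : term n) (T : C) (rho : Fin.t n -> hom T V) :
  forces w (is_colouring c a e) rho <->
  colours up (eval w rho c) (eval w rho a) (eval w rho e).
Proof.
rewrite /is_colouring /is_function !forces_And !forces_AllIn.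
have iff_and : forall A B D A' B' D' : Prop, (A <-> A') -> (B <-> B') -> (D <-> D') ->
  ((A /\ B) /\ D) <-> (A' /\ B' /\ D') by tauto.
apply: iff_and.
- split=> H U f z Hz; have L := H U f z Hz.
  + move/forces_ExIn: L => L; apply: (loc_bind L) => W k [x [Hx L']].
    have {}L' := proj1 (forces_Ex _ _ _) L'.
    apply: (loc_mono L') => W' k' [u]; rewrite forces_is_pair /= => Ez.
    exists (x ∘ k'), u; split.
    * move: Hx => /(mem_comp k'); rewrite eval_lift eval_restrict.
      by rewrite -!comp_assoc.
    * by rewrite comp_assoc.
  + apply/forces_ExIn; apply: (loc_mono L) => W k [x [u [Hx Ez]]].
    exists x; split; first by rewrite eval_lift eval_restrict -comp_assoc.
    by apply: (forces_here_ex (x := u)); rewrite forces_is_pair.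
- have E : forall (U : C) (f : hom U T) (x : hom U V) (W : C) (k : hom W U) (y : hom W V),
    forces w (pair_in v1 v0 (lift (lift c))) (scons y (restrict (scons x (restrict rho f)) k))
    <-> mem (opair up (x ∘ k) y) (eval w rho c ∘ (f ∘ k)).
  { move=> U f x W k y; rewrite forces_pair_in eval_lift restrict_scons eval_lift.
    by rewrite !eval_restrict -comp_assoc. }
  split=> H U f x Hx.
  + have /forces_ExU [u Hu] := H U f x Hx; exists u => W k y; by rewrite -E.
  + have [u Hu] := H U f x Hx; apply/forces_ExU; exists u => W k y; by rewrite E.
- have E : forall (U : C) (f : hom U T) (x u : hom U V),
    forces w (All (Iff (Mem v0 v1) (Ex (And (pair_in v3 v0 (lift (lift (lift (lift e)))))
      (pair_in v0 v1 (lift (lift (lift (lift c)))))))))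
      (scons u (scons x (restrict rho f))) <->
    forall (W : C) (k : hom W U) (y : hom W V), mem y (u ∘ k) <->
      locally (fun X l => exists x' : hom X V,
        mem (opair up (x ∘ k ∘ l) x') (eval w rho e ∘ (f ∘ k ∘ l)) /\
        mem (opair up x' (y ∘ l)) (eval w rho c ∘ (f ∘ k ∘ l))).
  { move=> U f x u; rewrite forces_all_iff.
    have E : forall (W : C) (k : hom W U) (y : hom W V),
      forces w (Ex (And (pair_in v3 v0 (lift (lift (lift (lift e)))))
        (pair_in v0 v1 (lift (lift (lift (lift c)))))))
        (scons y (restrict (scons u (scons x (restrict rho f))) k)) <->
      locally (fun X l => exists x' : hom X V,
        mem (opair up (x ∘ k ∘ l) x') (eval w rho e ∘ (f ∘ k ∘ l)) /\
        mem (opair up x' (y ∘ l)) (eval w rho c ∘ (f ∘ k ∘ l))).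
    { move=> W k y; rewrite forces_Ex; apply: loc_iff => X l.
      have E : forall x', forces w (And (pair_in v3 v0 (lift (lift (lift (lift e)))))
        (pair_in v0 v1 (lift (lift (lift (lift c))))))
        (scons x' (restrict (scons y (restrict (scons u (scons x (restrict rho f))) k)) l))
        <-> mem (opair up (x ∘ k ∘ l) x') (eval w rho e ∘ (f ∘ k ∘ l)) /\
        mem (opair up x' (y ∘ l)) (eval w rho c ∘ (f ∘ k ∘ l)).
      { move=> x'; rewrite forces_And !forces_pair_in !restrict_scons !eval_lift.
        by rewrite !restrict_comp !eval_restrict (comp_assoc f). }
      by split=> -[x' /E Hx']; exists x'. }
    by split=> H W k y; have := H W k y; rewrite E. }
  split.
  + move=> H U f x u Hx Hu y.
    have /forces_all_imp/(_ _ (idm U) u) := H U f x Hx.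
    rewrite restrict_idm forces_pair_in eval_lift eval_lift eval_restrict.
    move/(_ Hu)/E/(_ _ (idm U) y); rewrite !comp_idr; exact.
  + move=> H U f x Hx; apply/forces_all_imp => W k u.
    rewrite restrict_scons restrict_comp forces_pair_in eval_lift eval_lift eval_restrict.
    move=> Hu; apply/E => X l y.
    have Hx' : mem (x ∘ k ∘ l) (eval w rho a ∘ (f ∘ k ∘ l)).
    { move: Hx => /(mem_comp k)/(mem_comp l); by rewrite -!comp_assoc. }
    apply: (H X _ _ _ Hx'); move: Hu => /(mem_comp l).
    by rewrite opair_comp -!comp_assoc.
Qed.

(** The colouring is unique at each later stage because it is so at every stage
    and colourings restrict. *)
Lemma forces_AFA (T : C) (rho : Fin.t 0 -> hom T V) : forces w AFA rho.
Proof.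
move=> U f n; apply/forces_all_imp => W k e _; apply/forces_ExU.
set sigma := scons e _.
have [c Hc] := colours_exists HS HM HV Hup (sigma (FS F1)) (sigma F1).
exists c => X l y; rewrite forces_is_colouring; split.
- move=> Hy; apply: (colours_unique HS HM HV Hup Hy).
  have : forces w (is_colouring v0 v2 v1) (scons c sigma) by apply/forces_is_colouring.
  move/(forces_restrict l); rewrite restrict_scons => /forces_is_colouring; exact.
- move=> ->.
  have : forces w (is_colouring v0 v2 v1) (scons c sigma) by apply/forces_is_colouring.
  move/(forces_restrict l); rewrite restrict_scons => /forces_is_colouring; exact.
Qed.

End AntiFoundation.
End Validity.

Theorem corollary4p6 (C : heyting_pretopos) (N : nno C) (S : arrows C)
    (HS : small_maps S N) (HP2 : axiom_P2 S) (HM : axiom_M S) (HC : axiom_C S)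
    (V : coalgebra S) (HV : indexed_final_coalgebra V) (HB : boolean C) :
  exists omega : hom one (coalg_ob V),
    (forall (n : nat) (phi : form n),
       valid omega (closure (ExcludedMiddle phi))) /\
    (forall phi : form 0, ZFm phi \/ phi = AFA -> valid omega phi).
Proof.
have [o Ho] := empty_set HS HM HV.
have [s Hs] := successor HS HM HV.
have [up Hup] := unordered_pair HS HM HV.
have [num [num0 numS]] := numerals N o s.
have [w Hw] := numeral_set HS HM HV num.
have EM : forall n (phi : form n), valid w (closure (ExcludedMiddle phi)).
{ by move=> n phi; apply/valid_closure => T rho; apply: forces_excluded_middle. }
exists w; split=> // phi [H|->]; last first.
{ apply/(valid_closure w AFA) => T rho.
  exact: (@forces_AFA _ _ _ HS HM _ HV w _ Hup). }
case: H => {phi} // phi; case=> {phi} [phi|||].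
- case=> {phi}.
  + apply/valid_closure => T rho; exact: (@forces_extensionality _ _ _ HS HM _ HV w).
  + apply/valid_closure => T rho; exact: (@forces_pairing _ _ _ HS HM _ HV w).
  + apply/valid_closure => T rho; exact: (@forces_union _ _ _ HS HM _ HV w).
  + apply/(valid_closure w Emptyset) => T rho; exact: (@forces_emptyset _ _ _ HS HM _ HV w).
  + apply/valid_closure => T rho; exact: (@forces_intersection _ _ _ HS HM _ HV w).
  + move=> n a phi; apply/valid_closure => T rho.
    exact: (@forces_replacement _ _ _ HS HM _ HV w).
  + apply/(valid_closure w Infinity1) => T rho.
    exact: (forces_infinity1 HS HM HV Ho Hs num0 numS Hw).
  + move=> n psi; apply/valid_closure => T rho.
    exact: (forces_infinity2 HS HM HV Ho Hs num0 numS Hw).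
- apply/valid_closure => T rho; exact: (@forces_powerset _ _ _ HS HM _ HV w HP2).
- move=> n x phi; apply/valid_closure => T rho.
  exact: (@forces_separation _ _ _ HS HM _ HV w).
- move=> n x phi; apply/valid_closure => T rho.
  exact: (@forces_collection _ _ _ HS HM _ HV w HC).
Qed.
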